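(* Let $G$ be the zero-sum Bayesian game of the context, satisfying (i), (ii), (iv) and (v) there. For positive integers $N_1,N_2$, let $(\widetilde\sigma_1^*,\widetilde\sigma_2^* )$ be a DBNE$(N_1,N_2)$ of the discretized game $\widetilde G$, extended to step functions on $\Theta_1,\Theta_2$. Then there is $\epsilon_1=O\big(\max_{l\in\{1,2\},\,i\in\{1,\dots,N_l\}}(\theta_l^i-\theta_l^{i-1})\big)$, with the constant in $O(\cdot)$ depending only on $G$ and not on $N_1,N_2$, such that: (a) $(\widetilde\sigma_1^*,\widetilde\sigma_2^* )$ is an $\epsilon_1$-BNE of $G$; (b) if moreover (iii) of the context holds and $(\sigma_1^*,\sigma_2^* )$ is the BNE of $G$, then for $l\in\{1,2\}$, $$\lVert\widetilde\sigma_l^*-\sigma_l^*\rVert_{\mathcal H_l}^2\le\frac{4\epsilon_1}{\mu},$$ that is to say, as $N_1$ and $N_2$ tend to infinity, $\lim_{N_1,N_2\to\infty}\lVert\widetilde\sigma_l^*-\sigma_l^*\rVert_{\mathcal H_l}=0$.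
   Context: **Game $G$.** Two players (subnetworks) $\Xi_1,\Xi_2$; $\Xi_l$ consists of agents $v_l^1,\dots,v_l^{n_l}$ and has action set $\mathcal X_l\subseteq\mathbb R^{m_l}$ and type set $\Theta_l\subseteq\mathbb R$. Types have joint density $p(\theta_1,\theta_2)$ on $\Theta_1\times\Theta_2$, marginals $p_l(\theta_l)=\int_{\Theta_{3-l}}p\,d\theta_{3-l}$, conditional densities $p_l(\theta_{3-l}|\theta_l)=p(\theta_1,\theta_2)/p_l(\theta_l)$. Agent $v_l^i$ has cost $f_{l,i}:\mathcal X_1\times\mathcal X_2\times\Theta_1\times\Theta_2\to\mathbb R$, and $f_l=\frac1{n_l}\sum_{i=1}^{n_l}f_{l,i}$; zero-sum: $f_1+f_2=0$. $\Sigma_l$ is the set of measurable functions (strategies) $\sigma_l:\Theta_l\to\mathcal X_l$, with norm $\lVert\sigma\rVert_{\mathcal H_l}^2=\int_{\Theta_l}\lVert\sigma(\theta_l)\rVert^2p_l(\theta_l)d\theta_l$. Put $U_l(\sigma_1,\sigma_2,\theta_l)=\int_{\Theta_{3-l}}f_l(\sigma_1(\theta_1),\sigma_2(\theta_2),\theta_1,\theta_2)p_l(\theta_{3-l}|\theta_l)d\theta_{3-l}$. A BNE is a pair $(\sigma_1^*,\sigma_2^* )\in\Sigma_1\times\Sigma_2$ such that, for each $l$ and a.e. $\theta_l\in\Theta_l$, $\sigma_l^*(\theta_l)$ minimizes $U_l$ over the own action $\sigma_l(\theta_l)\in\mathcal X_l$ when the other plays $\sigma_{3-l}^*$ (under (i)-(iii)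 a unique BNE exists). For $\epsilon>0$, $(\widetilde\sigma_1,\widetilde\sigma_2)$ is an $\epsilon$-BNE of $G$ if for all $\sigma_1\in\Sigma_1,\sigma_2\in\Sigma_2$: $\int_{\Theta_1}U_1(\sigma_1,\widetilde\sigma_2,\theta_1)p_1(\theta_1)d\theta_1\ge\int_{\Theta_1}U_1(\widetilde\sigma_1,\widetilde\sigma_2,\theta_1)p_1(\theta_1)d\theta_1-\epsilon$ and $\int_{\Theta_2}U_2(\widetilde\sigma_1,\sigma_2,\theta_2)p_2(\theta_2)d\theta_2\ge\int_{\Theta_2}U_2(\widetilde\sigma_1,\widetilde\sigma_2,\theta_2)p_2(\theta_2)d\theta_2-\epsilon$. **Assumptions**, for $l\in\{1,2\}$: (i) $\mathcal X_l$ is nonempty, compact, convex. (ii) $\Theta_l=[\underline\theta_l,\overline\theta_l]$ is compact. (iii) $f_{l,i}$ is strictly convex in $x_l\in\mathcal X_l$, and $f_l$ is continuously differentiable and $\mu$-strongly convex ($\mu>0$) in $x_l\in\mathcal X_l$. (iv) For $j\in\{1,2\}$, $f_{l,i}$ is $L_{l,j}$-Lipschitz in $x_j\in\mathcal X_j$ (other arguments fixed) and $L_\theta$-Lipschitz in $\theta_j\in\Theta_j$ (other arguments fixed). (v) $p$ is $L_p$-Lipschitz in $\theta_l$ for each $\theta_{3-l}$, and $p_l(\theta_l)>0$ for all $\theta_l\in\Theta_l$. **Discretized game $\widetilde G$.** Choose $\underline\theta_l=\theta_l^0<\theta_l^1<\dots<\theta_l^{N_l}=\overline\theta_l$ with $\int_{\theta_l^{i-1}}^{\theta_l^i}p_l(\theta)d\theta=1/N_l$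 for all $i$; $\widetilde\Theta_l=\{\theta_l^1,\dots,\theta_l^{N_l}\}$. Set $\widetilde P(\theta_1^i,\theta_2^j)=\int_{\theta_1^{i-1}}^{\theta_1^i}\int_{\theta_2^{j-1}}^{\theta_2^j}p\,d\theta_2d\theta_1$, $\widetilde P_l(\theta_l)=\sum_{\theta_{3-l}\in\widetilde\Theta_{3-l}}\widetilde P(\theta_1,\theta_2)$, $\widetilde P_l(\theta_{3-l}|\theta_l)=\widetilde P(\theta_1,\theta_2)/\widetilde P_l(\theta_l)$. $\widetilde\Sigma_l$ is the set of maps $\widetilde\Theta_l\to\mathcal X_l$, and $\widetilde U_l(\sigma_1,\sigma_2,\theta_l)=\sum_{\theta_{3-l}\in\widetilde\Theta_{3-l}}f_l(\sigma_1(\theta_1),\sigma_2(\theta_2),\theta_1,\theta_2)\widetilde P_l(\theta_{3-l}|\theta_l)$ for $\theta_l\in\widetilde\Theta_l$. A DBNE$(N_1,N_2)$ is a pair $(\widetilde\sigma_1^*,\widetilde\sigma_2^* )\in\widetilde\Sigma_1\times\widetilde\Sigma_2$ such that for each $l$ and every $\theta_l\in\widetilde\Theta_l$, $\widetilde\sigma_l^*(\theta_l)$ minimizes $\widetilde U_l(\cdot,\cdot,\theta_l)$ over the own action in $\mathcal X_l$ when the other plays $\widetilde\sigma_{3-l}^*$. Elements of $\widetilde\Sigma_l$ are extended to $\Theta_l$ by $\widetilde\sigma_l(\theta)=\widetilde\sigma_l(\theta_l^i)$ for $\theta\in(\theta_l^{i-1},\theta_l^i]$. *)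

(* Defs.v *)
From HB Require Import structures.
From mathcomp Require Import all_boot all_order all_algebra.
From mathcomp Require Import all_classical all_reals all_analysis.

Set Implicit Arguments.
Unset Strict Implicit.
Unset Printing Implicit Defensive.

Import Order.TTheory GRing.Theory Num.Theory.
Import numFieldNormedType.Exports.

Local Open Scope classical_set_scope.
Local Open Scope ring_scope.

(* The two players are the booleans: [false] is player 1, [true] is player 2,
   and [~~ l] is the opponent of [l]. A pair (z_1, z_2) of objects attached to
   the players is a function on [bool]; [prof l u v] is the pair with
   component [u] for [l] and [v] for the opponent. *)
Definition prof (T : Type) (l : bool) (u v : T) : bool -> T :=
  fun k => if k == l then u else v.

Section Euclidean.
Context {R : realType} {m : nat}.

Definition dotv (u v : 'rV[R]_m) : R := \sum_(i < m) u 0 i * v 0 i.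

(* The library norm on row vectors is the max norm. *)
Definition norm2 (u : 'rV[R]_m) : R := Num.sqrt (dotv u u).

Definition strictly_convex_on (D : set 'rV[R]_m) (h : 'rV[R]_m -> R) : Prop :=
  forall u v, D u -> D v -> u != v -> forall a : R, 0 < a < 1 ->
    h (a *: u + (1 - a) *: v) < a * h u + (1 - a) * h v.

Definition strongly_convex_on (mu : R) (D : set 'rV[R]_m)
    (h : 'rV[R]_m -> R) : Prop :=
  forall u v, D u -> D v -> forall a : R, 0 <= a <= 1 ->
    h (a *: u + (1 - a) *: v) <=
      a * h u + (1 - a) * h v - mu / 2 * a * (1 - a) * norm2 (u - v) ^+ 2.

(* Continuous differentiability of a function that is given only on [D],
   which may have empty interior: a gradient relative to [D], continuous
   on [D]. *)
Definition continuously_differentiable_on (D : set 'rV[R]_m)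
    (h : 'rV[R]_m -> R) : Prop :=
  exists2 g : 'rV[R]_m -> 'rV[R]_m, {within D, continuous g} &
    forall u, D u -> forall e : R, 0 < e ->
      \forall v \near within D (nbhs u),
        `|h v - h u - dotv (g u) (v - u)| <= e * norm2 (v - u).

End Euclidean.

(* Costs and density are total functions of which only the values on the
   action and type sets are ever constrained or used. *)
Record game (R : realType) := Game {
  dim : bool -> nat;
  nagents : bool -> nat;
  actions : forall l, set 'rV[R]_(dim l);
  tmin : bool -> R;
  tmax : bool -> R;
  cost : forall l, 'I_(nagents l) ->
           (forall k, 'rV[R]_(dim k)) -> (bool -> R) -> R;
  density : (bool -> R) -> R;
  nagents_gt0 : forall l, (0 < nagents l)%N;
  density_ge0 : forall t, (forall k, t k \in `[tmin k, tmax k]) ->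
                  0 <= density t;
  density_measurable :
    measurable_fun (`[tmin false, tmax false] `*` `[tmin true, tmax true])
      (fun z : R * R => density (prof false z.1 z.2));
  density_mass :
    (\int[@lebesgue_measure R \x @lebesgue_measure R]_(z in
        `[tmin false, tmax false] `*` `[tmin true, tmax true])
      (density (prof false z.1 z.2))%:E = 1)%E
}.

Section BayesianGame.
Context {R : realType} (G : game R).

Local Notation leb := (@lebesgue_measure R).

Definition types (l : bool) : set R := `[tmin G l, tmax G l].

Definition action_profile := forall k, 'rV[R]_(dim G k).
Definition strategy_profile := forall k, R -> 'rV[R]_(dim G k).

Definition admissible (x : action_profile) : Prop :=
  forall k, actions (x k).
Definition typed (t : bool -> R) : Prop := forall k, types k (t k).

Definition play (s : strategy_profile) (t : bool -> R) : action_profile :=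
  fun k => s k (t k).

Definition deviate (s : strategy_profile) l (r : R -> 'rV[R]_(dim G l)) :
  strategy_profile := @dfwith bool (fun k => R -> 'rV[R]_(dim G k)) s l r.

Definition set_action (x : action_profile) l (u : 'rV[R]_(dim G l)) :
  action_profile := @dfwith bool (fun k => 'rV[R]_(dim G k)) x l u.

Definition set_type (t : bool -> R) (l : bool) (a : R) : bool -> R :=
  fun k => if k == l then a else t k.

Definition mean_cost l (x : action_profile) (t : bool -> R) : R :=
  (nagents G l)%:R^-1 * \sum_(i < nagents G l) cost i x t.

Definition zero_sum : Prop := forall x t, admissible x -> typed t ->
  mean_cost false x t + mean_cost true x t = 0.

Definition marginal l (a : R) : R :=
  \int[leb]_(b in types (~~ l)) density G (prof l a b).

(* p_l(b | a): [b] is the opponent's type, [a] the own type. *)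
Definition conditional l (b a : R) : R := density G (prof l a b) / marginal l a.

(* Measurability into R^m is measurability of all coordinates. *)
Definition strategy l (r : R -> 'rV[R]_(dim G l)) : Prop :=
  (forall j, measurable_fun (types l) (fun a => r a 0 j)) /\
  (forall a, types l a -> actions (r a)).

Definition sqHnorm l (r : R -> 'rV[R]_(dim G l)) : R :=
  \int[leb]_(a in types l) (norm2 (r a) ^+ 2 * marginal l a).

Definition Hnorm l (r : R -> 'rV[R]_(dim G l)) : R := Num.sqrt (sqHnorm r).

Definition Ucost l (s : strategy_profile) (a : R) : R :=
  \int[leb]_(b in types (~~ l))
    (mean_cost l (play s (prof l a b)) (prof l a b) * conditional l b a).

Definition mean_Ucost l (s : strategy_profile) : R :=
  \int[leb]_(a in types l) (Ucost l s a * marginal l a).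

(* [Ucost l s a] depends on the own strategy only through the action [s l a],
   so an own action [u] is represented by the constant strategy [u]. *)
Definition BNE (s : strategy_profile) : Prop :=
  (forall l, strategy (s l)) /\
  forall l, {ae leb, forall a, types l a ->
    forall u : 'rV[R]_(dim G l), actions u ->
      Ucost l s a <= Ucost l (deviate s (cst u)) a}.

Definition eps_BNE (eps : R) (s : strategy_profile) : Prop :=
  [/\ 0 < eps, forall l, strategy (s l) &
      forall l (r : R -> 'rV[R]_(dim G l)), strategy r ->
        mean_Ucost l (deviate s r) >= mean_Ucost l s - eps].

Definition actions_compact_convex : Prop := forall l,
  [/\ @actions _ G l !=set0, compact (@actions _ G l) &
      convex_set (@actions _ G l)].

Definition types_compact_interval : Prop := forall l, tmin G l <= tmax G l.

Definition costs_convex (mu : R) : Prop :=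
  0 < mu /\
  forall l x t, admissible x -> typed t ->
  [/\ forall i : 'I_(nagents G l),
        strictly_convex_on (@actions _ G l)
          (fun u => cost i (set_action x u) t),
      continuously_differentiable_on (@actions _ G l)
        (fun u => mean_cost l (set_action x u) t) &
      strongly_convex_on mu (@actions _ G l)
        (fun u => mean_cost l (set_action x u) t)].

Definition costs_lipschitz (L : bool -> bool -> R) (Ltheta : R) : Prop :=
  forall l (i : 'I_(nagents G l)) j x t, admissible x -> typed t ->
    (forall u v : 'rV[R]_(dim G j), actions u -> actions v ->
       `|cost i (set_action x u) t - cost i (set_action x v) t|
         <= L l j * norm2 (u - v)) /\
    Ltheta.-lipschitz_(types j) (fun a => cost i x (set_type t j a) : R^o).

Definition density_lipschitz_marginal_gt0 (Lp : R) : Prop := forall l,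
  (forall t, typed t ->
     Lp.-lipschitz_(types l) (fun a => density G (set_type t l a) : R^o)) /\
  (forall a, types l a -> 0 < marginal l a).

Section Discretized.
Variables (N : bool -> nat) (theta : bool -> nat -> R).

(* [theta l i] for [i <= N l] are the subdivision points of the type set of
   [l]; the discrete types are those with [0 < i <= N l]. *)
Definition cell l i : set R := `]theta l i.-1, theta l i].

Definition equiprobable_grid : Prop := forall l,
  [/\ theta l 0%N = tmin G l, theta l (N l) = tmax G l,
      forall i, (0 < i <= N l)%N -> theta l i.-1 < theta l i &
      forall i, (0 < i <= N l)%N ->
        \int[leb]_(a in cell l i) marginal l a = (N l)%:R^-1].

Definition mesh : R :=
  \big[Num.max/0]_(l : bool) \big[Num.max/0]_(1 <= i < (N l).+1)
    (theta l i - theta l i.-1).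

Definition Pd (i : bool -> nat) : R :=
  \int[leb]_(a in cell false (i false))
    \int[leb]_(b in cell true (i true)) density G (prof false a b).

Definition Pd_marginal l (i : nat) : R :=
  \sum_(1 <= j < (N (~~ l)).+1) Pd (prof l i j).

Definition Pd_conditional l (j i : nat) : R :=
  Pd (prof l i j) / Pd_marginal l i.

(* Of a strategy profile of the discretized game only the values at the
   discrete types matter. *)
Definition Ucost_d l (s : strategy_profile) (i : nat) : R :=
  \sum_(1 <= j < (N (~~ l)).+1)
    (let t := prof l (theta l i) (theta (~~ l) j) in
     mean_cost l (play s t) t * Pd_conditional l j i).

Definition DBNE (s : strategy_profile) : Prop :=
  (forall l i, (0 < i <= N l)%N -> actions (s l (theta l i))) /\
  forall l i, (0 < i <= N l)%N -> forall u : 'rV[R]_(dim G l), actions u ->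
    Ucost_d l s i <= Ucost_d l (deviate s (cst u)) i.

(* Smallest discrete type that is [>= a]: it sends [cell l i] to [theta l i],
   and the left endpoint [theta l 0], which lies in no cell, to [theta l 1]. *)
Definition round_up l (a : R) : R :=
  \big[Num.min/theta l (N l)]_(1 <= i < (N l).+1 | a <= theta l i) theta l i.

Definition step_extension (s : strategy_profile) : strategy_profile :=
  fun l a => s l (round_up l a).

End Discretized.

End BayesianGame.

(* Main.v *)
From Pilot Require Import Defs.
From HB Require Import structures.
From mathcomp Require Import all_boot all_order all_algebra.
From mathcomp Require Import all_classical all_reals all_analysis.
From mathcomp Require Import measurable_realfun ring lra.

Set Implicit Arguments.
Unset Strict Implicit.
Unset Printing Implicit Defensive.

Import Order.TTheory GRing.Theory Num.Theory.
Import numFieldNormedType.Exports.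
(* [dim] and [set_type] also name constants of the libraries imported above. *)
Import Pilot.Defs.

Local Open Scope classical_set_scope.
Local Open Scope ring_scope.

(** Write w_l(x, t) for the cost of player l times the density of the types, so
    that the expected cost of l is the iterated integral F_l(s) of w_l along
    the strategies s. On the compact set of admissible actions and types, w_l
    is bounded and Lipschitz in all its arguments.

    The step strategies are approximate equilibria. Fix the own type a in the
    cell i of player l and an own action u. On each cell j of the opponent the
    step strategy is constant, so that the integral of w_l(u, .) over that cell,
    multiplied by the width of the cell i, differs from the cost at the node
    (i, j) times the mass of the rectangle (i, j) by O(mesh) times the area of
    the rectangle: both the cost and the density move by O(mesh) within it
    ([node_cost_near]). Summing over j compares the conditional expected cost
    at a with the discrete objective, uniformly in u. The discrete equilibrium
    minimizes the latter, so it almost minimizes the former; integration over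
    a gives an error that is O(mesh) ([step_eps_BNE_bound]). No deviation has
    to be discretized: the comparison is made for one own action at a time.

    Closeness to the equilibrium s. Strong convexity integrates to strong
    convexity of F_l in the own strategy, so that deviating from s costs at
    least mu/2 times the squared distance ([BNE_strong_min]). Apply this to the
    deviation of each player to the approximate equilibrium s', and the
    approximate equilibrium property of s' to the deviations to s. As
    F_1 + F_2 = 0, adding these four inequalities cancels all values of F, and
    the sum of the two squared distances is at most 4 eps / mu
    ([eps_BNE_close]).

    Convergence. The marginals are continuous and positive on compact
    intervals, hence bounded below by some c > 0. A cell of mass 1/N thus has
    width at most 1/(c N), and the mesh tends to 0 ([mesh_le]). *)

(** * Measurability of Lipschitz functions of measurable maps *)

Section Measurability.
Context {d : measure_display} {T : measurableType d} {R : realType}.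
Implicit Types D : set T.

Lemma measurable_bigmin D (I : Type) (s : seq I) (M : R) (F : I -> T -> R) :
  (forall i, measurable_fun D (F i)) ->
  measurable_fun D (fun z => \big[Num.min/M]_(i <- s) F i z).
Proof.
move=> mF; elim: s => [|i s IHs].
  by under eq_fun do rewrite big_nil; exact: measurable_cst.
by under eq_fun do rewrite big_cons; exact: measurable_minr.
Qed.

Definition finite_nets {X : Type} (K : set X) (dist : X -> X -> R) : Prop :=
  forall e : R, 0 < e -> exists (I : finType) (q : I -> X),
    (forall i, K (q i)) /\ forall x, K x -> exists i, dist x (q i) <= e.

(** McShane's formula: f(p) is the infimum over q of f(q) + A dist(p, q). With q
    restricted to a finite net of mesh e the minimum is off by at most 2 A e,
    and along phi it is a finite minimum of measurable functions. Here X
    carries no measurable structure: the measurability of phi is expressed by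
    that of the functions dist(phi, q). *)
Lemma measurable_lipschitz_comp D (X : Type) (K : set X)
    (dist : X -> X -> R) (f : X -> R) (A M : R) (phi : T -> X) :
  0 <= A ->
  (forall x y, K x -> K y -> `|f x - f y| <= A * dist x y) ->
  (forall x, K x -> `|f x| <= M) ->
  finite_nets K dist ->
  (forall z, D z -> K (phi z)) ->
  (forall y, K y -> measurable_fun D (fun z => dist (phi z) y)) ->
  measurable_fun D (fun z => f (phi z)).
Proof.
move=> A0 lipf bndf nets Kphi mdist.
have /choice[N HN] : forall n, exists N : {I : finType & I -> X},
    (forall i, K (projT2 N i)) /\
    forall x, K x -> exists i, dist x (projT2 N i) <= n.+1%:R^-1.
  move=> n; have [|I [q Hq]] := nets (n.+1%:R^-1); first by rewrite invr_gt0.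
  by exists (existT _ I q).
pose g n z := \big[Num.min/M]_(i : projT1 (N n))
  (f (projT2 (N n) i) + A * dist (phi z) (projT2 (N n) i)).
(* M bounds f, so as the value of an empty minimum it stays above f. *)
apply: (@measurable_fun_cvg _ _ _ _ g).
  move=> n; apply: measurable_bigmin => i.
  apply: measurable_funD; first exact: measurable_cst.
  by apply: measurable_funM; [exact: measurable_cst|apply/mdist/(HN n).1].
move=> z Dz; have Kz := Kphi z Dz.
have lo n : f (phi z) <= g n z.
  apply: le_bigmin; first exact: le_trans (ler_norm _) (bndf _ Kz).
  move=> i _; rewrite -lerBlDl.
  exact: le_trans (ler_norm _) (lipf _ _ Kz ((HN n).1 i)).
have up n : g n z <= f (phi z) + 2 * A * n.+1%:R^-1.
  have [i di] := (HN n).2 _ Kz.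
  apply: le_trans (bigmin_le _ i _) _.
  have := lipf _ _ Kz ((HN n).1 i); rewrite ler_norml => /andP[h _].
  have : A * dist (phi z) (projT2 (N n) i) <= A * n.+1%:R^-1 by rewrite ler_wpM2l.
  move: h; set a := f _; set b := f _; set c := A * dist _ _; set e := A * _^-1.
  by rewrite -mulrA -/e => h1 h2; lra.
apply: (@squeeze_cvgr _ _ _ _ (cst (f (phi z)))
  (fun n => f (phi z) + 2 * A * n.+1%:R^-1)).
- by near=> n; rewrite /= lo up.
- exact: cvg_cst.
- rewrite -[X in _ --> X]addr0; apply: cvgD; first exact: cvg_cst.
  rewrite -(mulr0 (2 * A)); apply: cvgM; first exact: cvg_cst.
  exact: cvg_harmonic.
Unshelve. all: by end_near.
Qed.

End Measurability.

Lemma compact_finite_net {R : realType} {V : normedModType R} (K : set V) (e : R) :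
  compact K -> 0 < e -> exists (I : finType) (q : I -> V),
    (forall i, K (q i)) /\ forall x, K x -> exists i, `|x - q i| <= e.
Proof.
rewrite compact_cover => cK e0.
have [||S SK KS] := cK V K (fun q => ball q e).
- by move=> q _; apply: ball_open.
- by move=> x Kx; exists x => //; exact: ballxx.
exists 'I_(size (finmap.enum_fset S)), (fun i : 'I_(size (finmap.enum_fset S)) => nth 0 (finmap.enum_fset S) i).
split=> [i|x Kx].
  by have := SK (nth 0 (finmap.enum_fset S) i) (mem_nth _ (ltn_ord i)); rewrite inE.
have [q /= qS] := KS x Kx; rewrite -ball_normE /= => qx.
have qi : (index q (finmap.enum_fset S) < size (finmap.enum_fset S))%N.
  by rewrite index_mem.
by exists (Ordinal qi); rewrite /= nth_index// distrC ltW.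
Qed.

(** * Iterated integrals on rectangles *)

Lemma integrable_bounded {R : realType} (d : measure_display) (T : measurableType d)
    (mu : {measure set T -> \bar R}) (D : set T) (f : T -> R) (c : R) :
  measurable D -> (mu D < +oo)%E -> measurable_fun D f ->
  (forall x, D x -> `|f x| <= c) -> mu.-integrable D (EFin \o f).
Proof.
move=> mD fD mf bf; apply: measurable_bounded_integrable => //.
exists c; split; first exact: num_real.
by move=> y cy x Dx; apply: le_trans (bf _ Dx) (ltW cy).
Qed.

Section Rectangles.
Context {R : realType}.
Local Notation leb := (@lebesgue_measure R).
Variables (A B : set R) (g : R -> R -> R) (M : R).
Hypotheses (mA : measurable A) (mB : measurable B).
Hypotheses (fA : (leb A < +oo)%E) (fB : (leb B < +oo)%E).
Hypothesis mg : measurable_fun (A `*` B) (fun z : R * R => g z.1 z.2).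
Hypothesis bg : forall a b, A a -> B b -> `|g a b| <= M.

Lemma rectangle_finite : ((leb \x leb)%E (A `*` B) < +oo)%E.
Proof. by rewrite product_measure1E// lte_mul_pinfty// ge0_fin_numE. Qed.

Lemma integrable_rectangle :
  (leb \x leb)%E.-integrable (A `*` B) (EFin \o (fun z : R * R => g z.1 z.2)).
Proof.
apply: (@integrable_bounded R _ _ (leb \x leb)%E _ (fun z => g z.1 z.2) M) => //.
- exact: measurableX.
- exact: rectangle_finite.
- by move=> z [Az Bz]; exact: bg.
Qed.

Lemma measurable_section a : A a -> measurable_fun B (g a).
Proof.
move=> Aa.
apply: (@measurable_comp _ _ _ _ _ _ (A `*` B) (fun z : R * R => g z.1 z.2)
  B (fun b => (a, b))) => //.
- exact: measurableX.
- by move=> _ [b Bb <-].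
- by apply/measurable_funTS; exact: pair1_measurable.
Qed.

Lemma integrable_section a : A a -> leb.-integrable B (EFin \o g a).
Proof.
move=> Aa; apply: (@integrable_bounded _ _ _ _ _ _ M) => //.
- exact: measurable_section.
- by move=> b; exact: bg.
Qed.

(* The extension of g by 0, to which Fubini's theorem on the plane applies. *)
Let h : R * R -> \bar R := (fun z => (g z.1 z.2)%:E) \_ (A `*` B).

Let ih : (leb \x leb)%E.-integrable setT h.
Proof.
apply/(integrable_mkcond _ _).1; first exact: measurableX.
exact: integrable_rectangle.
Qed.

Let hF a : (\int[leb]_b h (a, b) =
  ((fun a => \int[leb]_(b in B) g a b) \_ A a)%:E)%E.
Proof.
rewrite /h patchE; case: ifPn => [/set_mem Aa|/negP nAa].
  rewrite /Rintegral fineK; last exact: integrable_fin_num (integrable_section _).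
  rewrite [in RHS]integral_mkcond; apply: eq_integral => b _.
  by rewrite !patchE in_setX/= mem_set.
rewrite integral0_eq// => b _; rewrite patchE in_setX/=; by case: (a \in A) nAa.
Qed.

Lemma integrable_inner :
  leb.-integrable A (EFin \o (fun a => \int[leb]_(b in B) g a b)).
Proof.
have [_] := @integrable_mkcond _ _ _ leb A
  (EFin \o (fun a => \int[leb]_(b in B) g a b)) mA; apply.
have := integrable_fubini_F ih; congr (integrable _ _ _).
apply/funext => a; rewrite /fubini_F hF.
by rewrite restrict_EFin.
Qed.

(** Turns an iterated integral into one integral over the rectangle, for which
    linearity and monotonicity are those of a single integral. *)
Lemma iterated_rectangle :
  \int[leb]_(a in A) \int[leb]_(b in B) g a b =
  \int[(leb \x leb)%E]_(z in A `*` B) g z.1 z.2.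
Proof.
rewrite [RHS]/Rintegral [in RHS]integral_mkcond -(integral12_prod_meas1 ih).
rewrite [LHS]/Rintegral [in LHS]integral_mkcond /fubini_F; congr fine; apply: eq_integral => a _.
by rewrite hF restrict_EFin.
Qed.

Lemma iterated_swap :
  \int[leb]_(b in B) \int[leb]_(a in A) g a b =
  \int[leb]_(a in A) \int[leb]_(b in B) g a b.
Proof.
have hG b : (\int[leb]_a h (a, b) =
    ((fun b => \int[leb]_(a in A) g a b) \_ B b)%:E)%E.
  rewrite /h patchE; case: ifPn => [/set_mem Bb|/negP nBb].
    rewrite /Rintegral fineK; last first.
      apply: integrable_fin_num => //.
      apply: (@integrable_bounded _ _ _ leb _ (fun a => g a b) M) => //; last first.
        by move=> a Aa; exact: bg.
      apply: (@measurable_comp _ _ _ _ _ _ (A `*` B)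
        (fun z : R * R => g z.1 z.2) A (fun a => (a, b))) => //.
      - exact: measurableX.
      - by move=> _ [a Aa <-].
      - by apply/measurable_funTS; exact: pair2_measurable.
    rewrite [in RHS]integral_mkcond; apply: eq_integral => a _.
    by rewrite !patchE in_setX/= (mem_set Bb) andbT.
  rewrite integral0_eq// => a _; rewrite patchE in_setX/=.
  by case: (b \in B) nBb; rewrite ?andbF.
rewrite [LHS]/Rintegral [RHS]/Rintegral [in LHS]integral_mkcond.
rewrite [in RHS]integral_mkcond; congr fine.
transitivity (\int[leb]_b \int[leb]_a h (a, b))%E.
  by apply: eq_integral => b _; rewrite hG restrict_EFin.
rewrite -(Fubini ih).
by apply: eq_integral => a _; rewrite hF restrict_EFin.
Qed.

End Rectangles.

Section Integrals.
Context {d : measure_display} {T : measurableType d} {R : realType}.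
Variables (mu : {measure set T -> \bar R}) (D : set T).
Hypothesis mD : measurable D.

Lemma Rintegral_near_cst (g : T -> R) (c e : R) :
  (mu D < +oo)%E -> mu.-integrable D (EFin \o g) ->
  (forall x, D x -> `|g x - c| <= e) ->
  `|\int[mu]_(x in D) g x - c * fine (mu D)| <= e * fine (mu D).
Proof.
move=> fD ig ge.
have ic (r : R) : mu.-integrable D (EFin \o cst r).
  by apply: (@integrable_bounded _ _ _ _ _ _ `|r|).
have lo : (c - e) * fine (mu D) <= \int[mu]_(x in D) g x.
  rewrite -(Rintegral_cst _ mD); apply: le_Rintegral => //; first exact: ic.
  move=> x /ge.
  by rewrite ler_norml => /andP[+ _]; rewrite /cst; lra.
have up : \int[mu]_(x in D) g x <= (c + e) * fine (mu D).
  rewrite -(Rintegral_cst _ mD); apply: le_Rintegral => //; first exact: ic.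
  move=> x /ge.
  by rewrite ler_norml => /andP[_ +]; rewrite /cst; lra.
by rewrite ler_norml; apply/andP; split; lra.
Qed.

(** As g - f agrees almost everywhere with its absolute value, its integral is
    nonnegative. *)
Lemma ae_le_Rintegral (f g : T -> R) :
  mu.-integrable D (EFin \o f) -> mu.-integrable D (EFin \o g) ->
  {ae mu, forall x, D x -> f x <= g x} ->
  \int[mu]_(x in D) f x <= \int[mu]_(x in D) g x.
Proof.
move=> if_ ig fg; rewrite -subr_ge0 -RintegralB//.
have mfg : measurable_fun D (f \- g).
  by apply: measurable_funB; apply/measurable_EFinP; apply: (measurable_int mu).
suff -> : \int[mu]_(x in D) (g x - f x) = \int[mu]_(x in D) `|g x - f x|.
  by apply: Rintegral_ge0.
congr fine; apply: ae_eq_integral => //.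
- apply/measurable_EFinP/measurable_funB;
  by apply/measurable_EFinP; apply: (measurable_int mu).
- apply/measurable_EFinP; apply: measurableT_comp => //; apply: measurable_funB;
  by apply/measurable_EFinP; apply: (measurable_int mu).
- move: fg; apply: filterS => x fg Dx; congr (_%:E).
  by rewrite ger0_norm// subr_ge0 fg.
Qed.

End Integrals.

Section IteratedIntegrals.
Context {R : realType}.
Local Notation leb := (@lebesgue_measure R).
Variables (A B : set R).
Hypotheses (mA : measurable A) (mB : measurable B).
Hypotheses (fA : (leb A < +oo)%E) (fB : (leb B < +oo)%E).

Definition bounded_measurable (g : R -> R -> R) : Prop :=
  measurable_fun (A `*` B) (fun z : R * R => g z.1 z.2) /\
  exists M, forall a b, A a -> B b -> `|g a b| <= M.

Local Notation dint g := (\int[leb]_(a in A) \int[leb]_(b in B) g a b).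

Let integrable2 g : bounded_measurable g ->
  (leb \x leb)%E.-integrable (A `*` B) (EFin \o (fun z : R * R => g z.1 z.2)).
Proof. by move=> [mg [M bg]]; exact: (integrable_rectangle (M := M)). Qed.

Let dintE g : bounded_measurable g ->
  dint g = \int[(leb \x leb)%E]_(z in A `*` B) g z.1 z.2.
Proof. by move=> [mg [M bg]]; exact: (iterated_rectangle (M := M)). Qed.

Let bounded_measurableZ g (c : R) :
  bounded_measurable g -> bounded_measurable (fun a b => c * g a b).
Proof.
move=> [mg [M bg]]; split; first exact: measurable_funM.
by exists (`|c| * M) => a b Aa Bb; rewrite normrM ler_wpM2l// bg.
Qed.

Lemma bounded_measurable_comb g1 g2 (c1 c2 : R) :
  bounded_measurable g1 -> bounded_measurable g2 ->
  bounded_measurable (fun a b => c1 * g1 a b + c2 * g2 a b).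
Proof.
move=> [m1 [M1 b1]] [m2 [M2 b2]]; split.
  by apply: measurable_funD; apply: measurable_funM.
exists (`|c1| * M1 + `|c2| * M2) => a b Aa Bb.
apply: le_trans (ler_normD _ _) _; rewrite !normrM.
by apply: lerD; rewrite ler_wpM2l// ?b1// b2.
Qed.

Lemma iterated_comb g1 g2 (c1 c2 : R) :
  bounded_measurable g1 -> bounded_measurable g2 ->
  dint (fun a b => c1 * g1 a b + c2 * g2 a b) = c1 * dint g1 + c2 * dint g2.
Proof.
move=> n1 n2; rewrite !dintE//; last exact: bounded_measurable_comb.
have mAB : measurable (A `*` B) by exact: measurableX.
have i1 := integrable2 n1; have i2 := integrable2 n2.
rewrite RintegralD//; last 2 first.
- exact: integrable2 (bounded_measurableZ c1 n1).
- exact: integrable2 (bounded_measurableZ c2 n2).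
by rewrite !RintegralZl.
Qed.

Lemma iterated_le g1 g2 : bounded_measurable g1 -> bounded_measurable g2 ->
  (forall a b, A a -> B b -> g1 a b <= g2 a b) -> dint g1 <= dint g2.
Proof.
move=> n1 n2 le12; rewrite !dintE//; apply: le_Rintegral.
- exact: measurableX.
- exact: integrable2.
- exact: integrable2.
- by move=> z [z1 z2]; exact: le12.
Qed.

End IteratedIntegrals.

(** * The Euclidean norm *)

Section Norm2.
Context {R : realType} {m : nat}.
Implicit Types u v : 'rV[R]_m.

Lemma dotv_ge0 u : 0 <= dotv u u.
Proof. by apply: sumr_ge0 => i _; rewrite -expr2 sqr_ge0. Qed.

Lemma norm2_ge0 u : 0 <= norm2 u.
Proof. exact: sqrtr_ge0. Qed.

Lemma norm2_sqr u : norm2 u ^+ 2 = dotv u u.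
Proof. by rewrite sqr_sqrtr// dotv_ge0. Qed.

Lemma norm2_0 : norm2 (0 : 'rV[R]_m) = 0.
Proof.
by rewrite /norm2 /dotv big1 ?sqrtr0// => i _; rewrite mxE mul0r.
Qed.

Lemma norm2_le_norm u : norm2 u <= m%:R * `|u|.
Proof.
have coord i : `|u 0 i| <= `|u|.
  rewrite [leRHS]mx_normrE.
  exact: (@le_bigmax _ _ _ _ (fun ij => `|u ij.1 ij.2|) (0, i)).
have mu0 : 0 <= m%:R * `|u| by rewrite mulr_ge0.
rewrite -(@ler_pXn2r _ 2)// ?nnegrE ?norm2_ge0//.
rewrite norm2_sqr exprMn.
apply: (@le_trans _ _ (\sum_(i < m) `|u| ^+ 2)).
  apply: ler_sum => i _; rewrite -expr2 -real_normK ?num_real//.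
  by rewrite ler_pXn2r// ?nnegrE.
rewrite sumr_const card_ord -[leLHS]mulr_natl; apply: ler_wpM2r.
  exact: sqr_ge0.
rewrite -natrX ler_nat.
by case: (m) => // k; rewrite expnS leq_pmulr.
Qed.

Lemma measurable_norm2 {d : measure_display} {T : measurableType d} (D : set T)
    (phi : T -> 'rV[R]_m) :
  (forall j, measurable_fun D (fun z => phi z 0 j)) ->
  measurable_fun D (fun z => norm2 (phi z)).
Proof.
move=> mphi; apply: measurableT_comp.
  by apply: continuous_measurable_fun; exact: sqrt_continuous.
by apply: measurable_sum => j; apply: measurable_funM.
Qed.

End Norm2.

(** * Functions of action and type profiles *)

Section Profiles.
Context {R : realType} {G : game R}.
Implicit Types (x y : action_profile G) (s t : bool -> R).

Definition profile_dist x y s t : R :=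
  \sum_(k : bool) (norm2 (x k - y k) + `|s k - t k|).

Definition profile_lipschitz (A : R)
    (h : action_profile G -> (bool -> R) -> R) : Prop :=
  forall x y s t, admissible x -> admissible y -> typed G s -> typed G t ->
    `|h x s - h y t| <= A * profile_dist x y s t.

Definition profile_bounded (M : R)
    (h : action_profile G -> (bool -> R) -> R) : Prop :=
  forall x t, admissible x -> typed G t -> `|h x t| <= M.

Lemma set_actionK x l : set_action x (x l) = x.
Proof.
apply: functional_extensionality_dep => k; rewrite /set_action.
have [<-|lk] := eqVneq l k; first by rewrite dfwithin.
by rewrite dfwithout.
Qed.

Lemma set_action2 x y : set_action (set_action y (x true)) (x false) = x.
Proof.
apply: functional_extensionality_dep => -[]; last by rewrite /set_action dfwithin.
by rewrite /set_action dfwithout// dfwithin.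
Qed.

Lemma set_action1 x y : set_action (set_action y (x true)) (y false) =
  set_action y (x true).
Proof.
apply: functional_extensionality_dep => -[]; rewrite /set_action.
  by rewrite dfwithout.
by rewrite dfwithin dfwithout.
Qed.

Lemma set_typeK t l : set_type t l (t l) = t.
Proof. by apply/funext => k; rewrite /set_type; case: eqP => // ->. Qed.

Lemma set_type2 s t : set_type (set_type t true (s true)) false (s false) = s.
Proof. by apply/funext => -[]. Qed.

Lemma set_type1 s t : set_type (set_type t true (s true)) false (t false) =
  set_type t true (s true).
Proof. by apply/funext => -[]. Qed.

Lemma admissible_set x l (u : 'rV[R]_(dim G l)) :
  admissible x -> actions u -> admissible (set_action x u).
Proof.
move=> xA uA k; rewrite /set_action.
have [<-|lk] := eqVneq l k; first by rewrite dfwithin.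
by rewrite dfwithout.
Qed.

Lemma typed_set t l a : typed G t -> types G l a -> typed G (set_type t l a).
Proof. by move=> tT aT k; rewrite /set_type; case: eqP => // ->. Qed.

(** Changing the four coordinates of a profile one after the other. *)
Lemma separately_lipschitz (A : R) (h : action_profile G -> (bool -> R) -> R) :
  (forall j x t (u v : 'rV[R]_(dim G j)), admissible x -> typed G t ->
    actions u -> actions v ->
    `|h (set_action x u) t - h (set_action x v) t| <= A * norm2 (u - v)) ->
  (forall j x t a b, admissible x -> typed G t -> types G j a -> types G j b ->
    `|h x (set_type t j a) - h x (set_type t j b)| <= A * `|a - b|) ->
  profile_lipschitz A h.
Proof.
move=> hx ht x y s t xA yA sT tT.
set x1 := set_action y (x true); set t1 := set_type t true (s true).
have x1A : admissible x1 by exact: admissible_set.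
have t1T : typed G t1 by exact: typed_set.
have h1 := hx false x1 s (x false) (y false) x1A sT (xA _) (yA _).
have h2 := hx true y s (x true) (y true) yA sT (xA _) (yA _).
have h3 := ht false y t1 (s false) (t false) yA t1T (sT _) (tT _).
have h4 := ht true y t (s true) (t true) yA tT (sT _) (tT _).
move: h1 h2 h3 h4.
rewrite set_action2 set_action1 set_actionK set_type2 set_type1 set_typeK.
rewrite -/x1 -/t1 /profile_dist big_bool /=.
move=> h1 h2 h3 h4.
apply: le_trans (ler_distD (h y t1) _ _) _.
apply: le_trans (lerD (ler_distD (h y s) _ _) h4) _.
apply: le_trans (lerD (lerD (ler_distD (h x1 s) _ _) h3) (lexx _)) _.
lra.
Qed.

Lemma profile_lipschitzM (A A' M M' : R) h h' :
  0 <= M -> 0 <= M' -> 0 <= A -> 0 <= A' ->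
  profile_lipschitz A h -> profile_lipschitz A' h' ->
  profile_bounded M h -> profile_bounded M' h' ->
  profile_lipschitz (A * M' + M * A') (fun x t => h x t * h' x t).
Proof.
move=> M0 M'0 A0 A'0 lh lh' bh bh' x y s t xA yA sT tT.
rewrite (_ : h x s * h' x s - h y t * h' y t = (h x s - h y t) * h' x s +
  h y t * (h' x s - h' y t)); last by ring.
apply: le_trans (ler_normD _ _) _; rewrite !normrM mulrDl; apply: lerD.
  by rewrite mulrAC ler_pM// ?lh// bh'.
by rewrite -mulrA ler_pM// ?lh'// bh.
Qed.

End Profiles.

Section CompactGame.
Context {R : realType} (G : game R).
Hypothesis HA : actions_compact_convex G.
Hypothesis HT : types_compact_interval G.

Lemma base_profile : exists x0 : action_profile G, admissible x0.
Proof.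
have [u0 U0] := (let: And3 a _ _ := HA false in a).
have [u1 U1] := (let: And3 a _ _ := HA true in a).
exists (fun k => if k as b return 'rV[R]_(dim G b) then u1 else u0).
by case.
Qed.

Lemma base_typed : typed G (tmin G).
Proof. by move=> k; rewrite /types /= in_itv /= lexx HT. Qed.

Lemma action_gap_bounded l : exists2 B : R, 0 <= B &
  forall u v : 'rV[R]_(dim G l), actions u -> actions v -> norm2 (u - v) <= B.
Proof.
have [[u0 U0] /compact_bounded[N [_ HN]] _] := HA l.
have bN (u : 'rV[R]_(dim G l)) : actions u -> `|u| <= N + 1 by move=> uA; apply: HN => //; rewrite ltrDl.
exists ((dim G l)%:R * ((N + 1) + (N + 1))).
  by rewrite mulr_ge0// addr_ge0// (le_trans _ (bN _ U0)).
move=> u v uA vA; apply: le_trans (norm2_le_norm _) _; rewrite ler_wpM2l//.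
by apply: le_trans (ler_normB _ _) _; apply: lerD; apply: bN.
Qed.

Lemma profile_lipschitz_bounded (A : R) h :
  0 <= A -> profile_lipschitz (G := G) A h ->
  exists2 M, 0 <= M & profile_bounded (G := G) M h.
Proof.
move=> A0 lh; have [x0 x0A] := base_profile; have t0T := base_typed.
have /choice[B HB] : forall k, exists B : R, forall u v : 'rV[R]_(dim G k),
    actions u -> actions v -> norm2 (u - v) <= B.
  by move=> k; have [B _ HB] := action_gap_bounded k; exists B.
set b := A * \sum_(k : bool) (B k + `|tmax G k - tmin G k|).
have key x t : admissible x -> typed G t -> `|h x t| <= `|h x0 (tmin G)| + b.
  move=> xA tT; rewrite -[h x t](subrK (h x0 (tmin G))) addrC.
  apply: le_trans (ler_normD _ _) _; rewrite lerD2l.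
  apply: le_trans (lh _ _ _ _ xA x0A tT t0T) _; rewrite ler_wpM2l//.
  apply: ler_sum => k _; apply: lerD; first exact: HB.
  have := tT k; rewrite /types/= in_itv/= => /andP[a1 a2].
  by rewrite !ger0_norm ?subr_ge0// lerD2r.
exists (`|h x0 (tmin G)| + b) => //.
exact: le_trans (key _ _ x0A t0T).
Qed.

(** Products of nets of the four compact coordinate sets; each coordinate gets a
    quarter of the tolerance. *)
Lemma profile_nets :
  finite_nets [set p : action_profile G * (bool -> R) | admissible p.1 /\ typed G p.2]
    (fun p q => profile_dist p.1 q.1 p.2 q.2).
Proof.
move=> e e0.
have netA k : exists (I : finType) (q : I -> 'rV[R]_(dim G k)),
    (forall i, actions (q i)) /\
    forall u, actions u -> exists i, norm2 (u - q i) <= e / 4.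
  have [_ cA _] := HA k.
  pose e' : R := e / 4 / (dim G k).+1%:R.
  have e'0 : 0 < e' by rewrite !divr_gt0.
  have [I [q [qA qn]]] := compact_finite_net cA e'0.
  exists I, q; split=> // u /qn[i ui]; exists i.
  apply: le_trans (norm2_le_norm _) _.
  apply: (@le_trans _ _ ((dim G k).+1%:R * e')).
    by rewrite ler_pM// ler_nat.
  by rewrite /e' mulrC divfK.
have netT k : exists (I : finType) (q : I -> R),
    (forall i, types G k (q i)) /\
    forall a, types G k a -> exists i, `|a - q i| <= e / 4.
  apply: (@compact_finite_net R R^o) => //; last by rewrite divr_gt0.
  exact: segment_compact.
have [I0 [q0 [q0A q0n]]] := netA false.
have [I1 [q1 [q1A q1n]]] := netA true.
have [J0 [r0 [r0A r0n]]] := netT false.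
have [J1 [r1 [r1A r1n]]] := netT true.
exists ((I0 * I1) * (J0 * J1))%type, (fun i =>
  ((fun k => if k as b return 'rV[R]_(dim G b) then q1 i.1.2 else q0 i.1.1),
   (fun k => if k then r1 i.2.2 else r0 i.2.1))).
split=> [i|[x t] [/= xA tT]]; first by split; case => /=.
have [i0 h0] := q0n _ (xA false).
have [i1 h1] := q1n _ (xA true).
have [j0 g0] := r0n _ (tT false).
have [j1 g1] := r1n _ (tT true).
exists ((i0, i1), (j0, j1)); rewrite /profile_dist big_bool /=; lra.
Qed.

(** The measurability of every integrand below comes from this lemma: strategies
    are only assumed measurable one at a time and coordinatewise, and the costs
    are only constrained on the admissible profiles. *)
Lemma measurable_profile (d : measure_display) (T : measurableType d)
    (D : set T) (A : R) h (phi : T -> action_profile G) (tau : T -> bool -> R) :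
  0 <= A -> profile_lipschitz (G := G) A h ->
  (forall z, D z -> admissible (phi z) /\ typed G (tau z)) ->
  (forall k j, measurable_fun D (fun z => phi z k 0 j)) ->
  (forall k, measurable_fun D (fun z => tau z k)) ->
  measurable_fun D (fun z => h (phi z) (tau z)).
Proof.
move=> A0 lh adm mphi mtau.
have [M M0 bh] := profile_lipschitz_bounded A0 lh.
apply: (@measurable_lipschitz_comp _ T R D
  (action_profile G * (bool -> R))%type _ _ (fun p => h p.1 p.2)
  A M (fun z => (phi z, tau z)) A0 _ _ profile_nets) => //=.
- by move=> p q [p1 p2] [q1 q2]; exact: lh.
- by move=> p [p1 p2]; exact: bh.
- move=> p _; apply: measurable_sum => k; apply: measurable_funD.
    apply: measurable_norm2 => j.
    under eq_fun do rewrite !mxE.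
    exact: measurable_funB.
  by apply: measurableT_comp => //; exact: measurable_funB.
Qed.

End CompactGame.

(** * Expected costs as iterated integrals *)

(** The cost times the joint density. Using it instead of the cost and the
    conditional density removes the division by the marginal. *)
Definition weighted_cost {R : realType} {G : game R} l (x : action_profile G)
    (t : bool -> R) : R := mean_cost l x t * density G t.

Definition payoff {R : realType} {G : game R} l (s : strategy_profile G)
    (a b : R) : R := weighted_cost l (play s (prof l a b)) (prof l a b).

Definition strategies {R : realType} {G : game R} (s : strategy_profile G) :=
  forall l, strategy (s l).

Section Bounds.
Context {R : realType} (G : game R).
Variables (L : bool -> bool -> R) (Ltheta Lp : R).
Hypothesis HL : costs_lipschitz G L Ltheta.
Hypothesis HD : density_lipschitz_marginal_gt0 G Lp.

Lemma mean_cost_lipschitz :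
  exists2 A, 0 <= A & forall l, profile_lipschitz (G := G) A (mean_cost l).
Proof.
pose A : R := `|Ltheta| + \sum_(l : bool) \sum_(j : bool) `|L l j|.
exists A; first by rewrite addr_ge0// sumr_ge0// => l _; rewrite sumr_ge0.
have LA l j : L l j <= A.
  apply: le_trans (ler_norm _) _; rewrite /A !big_bool /=.
  by case: l; case: j; have := normr_ge0 Ltheta; have := normr_ge0 (L true true);
    have := normr_ge0 (L true false); have := normr_ge0 (L false true);
    have := normr_ge0 (L false false); lra.
have LtA : Ltheta <= A.
  apply: le_trans (ler_norm _) _; rewrite /A lerDl.
  by rewrite sumr_ge0// => l _; rewrite sumr_ge0.
have mean l x y s t (e : R) :
    (forall i : 'I_(nagents G l), `|cost i x s - cost i y t| <= e) ->
    `|mean_cost l x s - mean_cost l y t| <= e.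
  move=> H; rewrite /mean_cost -mulrBr -sumrB normrM ger0_norm ?invr_ge0//.
  rewrite ler_pdivrMl ?ltr0n ?nagents_gt0//.
  apply: le_trans (ler_norm_sum _ _ _) _.
  apply: (@le_trans _ _ (\sum_(i < nagents G l) e)); first by apply: ler_sum.
  by rewrite sumr_const card_ord mulr_natl.
move=> l; apply: separately_lipschitz.
  move=> j x t u v xA tT uA vA; apply: mean => i.
  apply: le_trans ((HL i j xA tT).1 u v uA vA) _.
  by rewrite ler_wpM2r// norm2_ge0.
move=> j x t a b xA tT aT bT; apply: mean => i.
apply: le_trans ((HL i j xA tT).2 (a, b) _) _ => //=.
by rewrite ler_wpM2r.
Qed.

Lemma density_profile_lipschitz :
  exists2 P, 0 <= P & profile_lipschitz (G := G) P (fun=> density G).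
Proof.
exists `|Lp| => //; apply: separately_lipschitz.
  by move=> j x t u v *; rewrite subrr normr0 mulr_ge0// norm2_ge0.
move=> j x t a b _ tT aT bT.
apply: le_trans ((HD j).1 t tT (a, b) _) _ => //=.
by rewrite ler_wpM2r// ler_norm.
Qed.

End Bounds.

(** All that the argument uses of the game besides the zero-sum property and the
    convexity of the costs. The discretization error depends on the game only
    through A, M, P, Q and the lengths of the type intervals. *)
Record regular_game {R : realType} (G : game R) (A M P Q : R) : Prop := {
  regular_actions : actions_compact_convex G;
  regular_types : types_compact_interval G;
  cost_modulus_ge0 : 0 <= A;
  cost_bound_ge0 : 0 <= M;
  density_modulus_ge0 : 0 <= P;
  density_bound_ge0 : 0 <= Q;
  cost_modulus : forall l, profile_lipschitz (G := G) A (mean_cost l);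
  density_modulus : profile_lipschitz (G := G) P (fun=> density G);
  cost_bound : forall l, profile_bounded (G := G) M (mean_cost l);
  density_bound : profile_bounded (G := G) Q (fun=> density G);
  regular_marginal : forall l a, types G l a -> 0 < marginal G l a }.

Lemma regular_game_exists {R : realType} (G : game R)
    (L : bool -> bool -> R) (Ltheta Lp : R) :
  actions_compact_convex G -> types_compact_interval G ->
  costs_lipschitz G L Ltheta -> density_lipschitz_marginal_gt0 G Lp ->
  exists A M P Q, regular_game G A M P Q.
Proof.
move=> HA HT HL HD.
have [A A0 lipA] := mean_cost_lipschitz HL.
have [P P0 lipP] := density_profile_lipschitz HD.
have [M0 M00 bnd0] := profile_lipschitz_bounded HA HT A0 (lipA false).
have [M1 M10 bnd1] := profile_lipschitz_bounded HA HT A0 (lipA true).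
have [Q Q0 bndQ] := profile_lipschitz_bounded HA HT P0 lipP.
exists A, (M0 + M1), P, Q; split=> //; first exact: addr_ge0.
  case=> x t xA tT.
    by rewrite (le_trans (bnd1 x t xA tT))// lerDr.
  by rewrite (le_trans (bnd0 x t xA tT))// lerDl.
by move=> l a; exact: (HD l).2.
Qed.

Section Payoffs.
Context {R : realType} (G : game R).
Local Notation leb := (@lebesgue_measure R).
Variables (A M P Q : R).
Hypothesis reg : regular_game G A M P Q.
Let HA := regular_actions reg.
Let HT := regular_types reg.
Let A0 := cost_modulus_ge0 reg.
Let M0 := cost_bound_ge0 reg.
Let P0 := density_modulus_ge0 reg.
Let Q0 := density_bound_ge0 reg.
Let lipA := cost_modulus reg.
Let lipP := density_modulus reg.
Let bndM := cost_bound reg.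
Let bndQ := density_bound reg.
Let marginal_gt0 := regular_marginal reg.

Lemma measurable_types l : measurable (types G l).
Proof. exact: measurable_itv. Qed.

Lemma types_finite l : (leb (types G l) < +oo)%E.
Proof. by rewrite /types lebesgue_measure_itv; case: ifP => _; rewrite ?ltry. Qed.

Hint Extern 0 (measurable (types _ _)) => exact: measurable_types : core.
Hint Resolve types_finite : core.

Lemma typed_prof l a b : types G l a -> types G (~~ l) b -> typed G (prof l a b).
Proof.
by move=> aT bT k; rewrite /prof; case: eqP => [->//|]; case: k l aT bT => -[].
Qed.

Lemma admissible_play (s : strategy_profile G) t : strategies s -> typed G t ->
  admissible (play s t).
Proof. by move=> sS tT k; apply: (sS k).2. Qed.

Lemma weighted_cost_lipschitz l :
  profile_lipschitz (G := G) (A * Q + M * P) (weighted_cost l).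
Proof. exact: profile_lipschitzM. Qed.

Lemma measurable_profile_payoff (B : R) h (s : strategy_profile G) l :
  0 <= B -> profile_lipschitz (G := G) B h -> strategies s ->
  measurable_fun (types G l `*` types G (~~ l))
    (fun z : R * R => h (play s (prof l z.1 z.2)) (prof l z.1 z.2)).
Proof.
move=> B0 lh sS; apply: (measurable_profile HA HT B0 lh) => [z [za zb]|k j|k].
- have zT := typed_prof za zb; split=> //; exact: admissible_play.
- rewrite /play /prof; case: eqP => [kl|kl].
    apply: (@measurable_comp _ _ _ _ _ _ (types G k) (fun a => s k a 0 j) _ fst).
    + by [].
    + by move=> _ [z [z1 z2] <-]; rewrite kl.
    + exact: (sS k).1.
    + by apply: measurable_funTS; exact: measurable_fst.
  apply: (@measurable_comp _ _ _ _ _ _ (types G k) (fun a => s k a 0 j) _ snd).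
  + by [].
  + move=> _ [z [z1 z2] <-]; have -> // : k = ~~ l by move: kl; case: (k); case: (l).
  + exact: (sS k).1.
  + by apply: measurable_funTS; exact: measurable_snd.
- rewrite /prof; case: eqP => _; apply: measurable_funTS;
  [exact: measurable_fst|exact: measurable_snd].
Qed.

Lemma measurable_payoff (s : strategy_profile G) l : strategies s ->
  measurable_fun (types G l `*` types G (~~ l))
    (fun z : R * R => payoff l s z.1 z.2).
Proof.
move=> sS; apply: measurable_profile_payoff (weighted_cost_lipschitz l) sS.
by rewrite addr_ge0// mulr_ge0.
Qed.

Lemma payoff_bounded (s : strategy_profile G) l a b : strategies s ->
  types G l a -> types G (~~ l) b -> `|payoff l s a b| <= M * Q.
Proof.
move=> sS aT bT; rewrite normrM; have tT := typed_prof aT bT.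
have xA := admissible_play sS tT.
by rewrite ler_pM// ?bndM//; exact: (bndQ xA).
Qed.

Lemma integrable_payoff (s : strategy_profile G) l a : strategies s ->
  types G l a -> leb.-integrable (types G (~~ l)) (EFin \o payoff l s a).
Proof.
move=> sS; apply: (integrable_section (M := M * Q)) => //.
  exact: measurable_payoff.
by move=> a' b'; exact: payoff_bounded.
Qed.

Lemma integrable_payoff_inner (s : strategy_profile G) l : strategies s ->
  leb.-integrable (types G l)
    (EFin \o (fun a => \int[leb]_(b in types G (~~ l)) payoff l s a b)).
Proof.
move=> sS; apply: (integrable_inner (M := M * Q)) => //.
  exact: measurable_payoff.
by move=> a' b'; exact: payoff_bounded.
Qed.

(** The marginal in the conditional density cancels, since it is positive. *)
Lemma Ucost_marginal (s : strategy_profile G) l a : strategies s ->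
  types G l a ->
  Ucost l s a * marginal G l a = \int[leb]_(b in types G (~~ l)) payoff l s a b.
Proof.
move=> sS aT; have m0 := marginal_gt0 aT.
transitivity ((\int[leb]_(b in types G (~~ l))
    (payoff l s a b * (marginal G l a)^-1)) * marginal G l a).
  congr (_ * _); apply: eq_Rintegral => b _.
  by rewrite /payoff /weighted_cost /conditional mulrA.
rewrite RintegralZr//; first by rewrite divfK// gt_eqF.
exact: integrable_payoff.
Qed.

Lemma mean_UcostE (s : strategy_profile G) l : strategies s ->
  mean_Ucost l s =
  \int[leb]_(a in types G l) \int[leb]_(b in types G (~~ l)) payoff l s a b.
Proof.
by move=> sS; apply: eq_Rintegral => a; rewrite inE => /Ucost_marginal ->.
Qed.

Lemma prof_swap (T : Type) (u v : T) : prof true v u = prof false u v.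
Proof. by apply/funext => -[]. Qed.

(** The two expected costs integrate opposite functions in opposite orders. *)
Lemma mean_Ucost_zero_sum (s : strategy_profile G) : zero_sum G ->
  strategies s -> mean_Ucost true s = - mean_Ucost false s.
Proof.
move=> Z sS; rewrite !mean_UcostE//.
have bnd l a b := @payoff_bounded s l a b sS.
transitivity (\int[leb]_(b in types G true) \int[leb]_(a in types G false)
    (- 1 * payoff false s a b)).
  apply: eq_Rintegral => b; rewrite inE => bT.
  apply: eq_Rintegral => a; rewrite inE => aT.
  rewrite /payoff prof_swap /weighted_cost.
  have tT : typed G (prof false a b) by exact: typed_prof.
  have := Z _ _ (admissible_play sS tT) tT.
  by move/eqP; rewrite addr_eq0 => /eqP ->; rewrite !mulNr mul1r opprK.
rewrite (@iterated_swap _ _ _ (fun a b => - 1 * payoff false s a b) (M * Q))//.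
- under eq_Rintegral => a.
    rewrite inE => aT; rewrite RintegralZl//; last first.
      exact: (integrable_payoff (l := false) sS aT).
    over.
  rewrite RintegralZl ?mulN1r//; exact: (integrable_payoff_inner false sS).
- by apply: measurable_funM => //; exact: measurable_payoff false sS.
- by move=> a b aT bT; rewrite mulN1r normrN; exact: bnd.
Qed.

Lemma strategies_deviate (s : strategy_profile G) l (r : R -> 'rV[R]_(dim G l)) :
  strategies s -> strategy r -> strategies (deviate s r).
Proof.
move=> sS rS k; rewrite /deviate; have [<-|lk] := eqVneq l k.
  by rewrite dfwithin.
by rewrite dfwithout.
Qed.

End Payoffs.

(** * Strong convexity and the distance to the equilibrium *)

Lemma le_of_scaled (R : realFieldType) (X D : R) : 0 <= D ->
  (forall c, 0 < c < 1 -> (1 - c) * X <= D) -> X <= D.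
Proof.
move=> D0 scaled; rewrite leNgt; apply/negP => DX.
have X0 : 0 < X := le_lt_trans D0 DX.
(* This c makes (1 - c) X the midpoint of D and X. *)
have := scaled ((X - D) / (2 * X)).
have -> : 0 < (X - D) / (2 * X) < 1.
  apply/andP; split; first by rewrite divr_gt0 ?mulr_gt0 ?subr_gt0.
  by rewrite ltr_pdivrMr ?mulr_gt0//; lra.
have -> : (1 - (X - D) / (2 * X)) * X = (X + D) / 2.
  by field; rewrite gt_eqF.
by move=> /(_ isT); lra.
Qed.

Section StrongConvexity.
Context {R : realType} (G : game R).
Local Notation leb := (@lebesgue_measure R).
Variables (A M P Q : R).
Hypothesis reg : regular_game G A M P Q.

(** Against given types, a deviation only matters through the action that it
    prescribes at the own type. *)
Lemma play_deviate (s : strategy_profile G) l (q : R -> 'rV[R]_(dim G l)) a b :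
  play (deviate s q) (prof l a b) = set_action (play s (prof l a b)) (q a).
Proof.
apply: functional_extensionality_dep => k; rewrite /play /deviate /set_action.
have [<-|lk] := eqVneq l k; first by rewrite !dfwithin /prof eqxx.
by rewrite !dfwithout.
Qed.

Lemma play_self (s : strategy_profile G) l a b :
  play s (prof l a b) = set_action (play s (prof l a b)) (s l a).
Proof.
have -> : s l a = play s (prof l a b) l by rewrite /play /prof eqxx.
by rewrite set_actionK.
Qed.

Lemma bounded_measurable_payoff (s : strategy_profile G) l : strategies s ->
  bounded_measurable (types G l) (types G (~~ l)) (payoff l s).
Proof.
move=> sS; split; first exact: measurable_payoff reg _ _ sS.
by exists (M * Q) => a b; exact: payoff_bounded reg _ _ _ _ sS.
Qed.

Definition mix_strategy l (c : R) (r q : R -> 'rV[R]_(dim G l)) :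
  R -> 'rV[R]_(dim G l) := fun a => c *: r a + (1 - c) *: q a.

Lemma strategy_mix l (c : R) (r q : R -> 'rV[R]_(dim G l)) : 0 <= c <= 1 ->
  strategy r -> strategy q -> strategy (mix_strategy c r q).
Proof.
move=> /andP[c0 c1] [mr rA] [mq qA]; split=> [j|a aT].
  rewrite /mix_strategy; under eq_fun do rewrite !mxE.
  by apply: measurable_funD; apply: measurable_funM.
have [_ _ cA] := regular_actions reg l.
have := cA (r a) (q a) (Itv01 c0 c1) (mem_set (rA _ aT)) (mem_set (qA _ aT)).
by rewrite inE.
Qed.

Definition weighted_gap l (r : R -> 'rV[R]_(dim G l)) (a b : R) : R :=
  norm2 (r a) ^+ 2 * density G (prof l a b).

Lemma constant_strategies : exists s : strategy_profile G, strategies s.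
Proof.
have [x0 x0A] := base_profile (regular_actions reg).
by exists (fun k => cst (x0 k)).
Qed.

Lemma bounded_measurable_density l :
  bounded_measurable (types G l) (types G (~~ l)) (fun a b => density G (prof l a b)).
Proof.
have [s sS] := constant_strategies; split.
  have := measurable_profile_payoff reg (l := l) (density_modulus_ge0 reg)
    (density_modulus reg) sS.
  exact.
exists Q => a b aT bT; have tT := typed_prof aT bT.
exact: (density_bound reg (admissible_play sS tT) tT).
Qed.

Lemma integrable_density l a : types G l a ->
  leb.-integrable (types G (~~ l)) (EFin \o (fun b => density G (prof l a b))).
Proof.
have [mp [B bB]] := bounded_measurable_density l.
by apply: (integrable_section (A := types G l)
  (g := fun a b => density G (prof l a b)) (M := B)) => //;
  [exact: measurable_types|exact: measurable_types|exact: types_finite].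
Qed.

Lemma bounded_measurable_gap (s : strategy_profile G) l
    (r : R -> 'rV[R]_(dim G l)) : strategies s -> strategy r ->
  bounded_measurable (types G l) (types G (~~ l))
    (weighted_gap (fun a => r a - s l a)).
Proof.
move=> sS rS; split.
  apply: measurable_funM; last exact: (bounded_measurable_density l).1.
  apply: measurable_funX.
  apply: (@measurable_comp _ _ _ _ _ _ (types G l)
    (fun a => norm2 (r a - s l a)) _ fst).
  - exact: measurable_types.
  - by move=> _ [z [z1 z2] <-].
  - apply: measurable_norm2 => j; under eq_fun do rewrite !mxE.
    by apply: measurable_funB; [exact: rS.1|exact: (sS l).1].
  - by apply: measurable_funTS; exact: measurable_fst.
have [B B0 HB] := action_gap_bounded (regular_actions reg) l.
exists (B ^+ 2 * Q) => a b aT bT; rewrite normrM ler_pM//.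
  rewrite ger0_norm ?sqr_ge0// ler_pXn2r// ?nnegrE ?norm2_ge0// HB//.
    exact: rS.2.
  exact: (sS l).2.
have tT := typed_prof aT bT.
exact: (density_bound reg (admissible_play sS tT) tT).
Qed.

Lemma sqHnormE l (r : R -> 'rV[R]_(dim G l)) (s : strategy_profile G) :
  strategies s -> strategy r ->
  sqHnorm (fun a => r a - s l a) =
  \int[leb]_(a in types G l) \int[leb]_(b in types G (~~ l))
    weighted_gap (fun a => r a - s l a) a b.
Proof.
move=> sS rS; apply: eq_Rintegral => a; rewrite inE => aT.
rewrite /weighted_gap RintegralZl//; first exact: measurable_types.
exact: integrable_density.
Qed.

Lemma payoff_mix (mu : R) (s : strategy_profile G) l
    (r : R -> 'rV[R]_(dim G l)) (c a b : R) :
  costs_convex G mu -> strategies s -> strategy r -> 0 <= c <= 1 ->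
  types G l a -> types G (~~ l) b ->
  payoff l (deviate s (mix_strategy c r (s l))) a b <=
    c * payoff l (deviate s r) a b + (1 - c) * payoff l s a b
    - mu / 2 * c * (1 - c) * weighted_gap (fun a => r a - s l a) a b.
Proof.
move=> [mu0 cvx] sS rS c01 aT bT.
have tT := typed_prof aT bT; have xA := admissible_play sS tT.
have [_ _ sc] := cvx l _ _ xA tT.
have {sc} := sc (r a) (s l a) (rS.2 _ aT) ((sS l).2 _ aT) c c01.
rewrite -play_self => sc.
have d0 : 0 <= density G (prof l a b) by apply: density_ge0 => k; exact: tT.
move: (ler_wpM2r d0 sc).
rewrite /payoff /weighted_cost /weighted_gap !play_deviate => H.
apply: le_trans H _; lra.
Qed.

Lemma mean_Ucost_mix (mu : R) (s : strategy_profile G) l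
    (r : R -> 'rV[R]_(dim G l)) (c : R) :
  costs_convex G mu -> strategies s -> strategy r -> 0 <= c <= 1 ->
  mean_Ucost l (deviate s (mix_strategy c r (s l))) <=
    c * mean_Ucost l (deviate s r) + (1 - c) * mean_Ucost l s
    - mu / 2 * c * (1 - c) * sqHnorm (fun a => r a - s l a).
Proof.
move=> mu_cvx sS rS c01.
have sr := strategies_deviate sS rS.
have sm := strategies_deviate sS (strategy_mix c01 rS (sS l)).
rewrite !(mean_UcostE reg)// sqHnormE// -mulNr.
have p1 := bounded_measurable_payoff l sr.
have p2 := bounded_measurable_payoff l sS.
have p3 := bounded_measurable_gap sS rS.
have mT := @measurable_types _ G; have fT := @types_finite _ G.
have E1 := iterated_comb (mT _) (mT _) (fT _) (fT _) c (1 - c) p1 p2.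
have p12 := bounded_measurable_comb c (1 - c) p1 p2.
have E2 := iterated_comb (mT _) (mT _) (fT _) (fT _)
  1 (- (mu / 2 * c * (1 - c))) p12 p3.
rewrite -E1 -[leRHS]/(_ + _) -[X in X + _]mul1r -E2.
apply: iterated_le => //.
- exact: bounded_measurable_payoff.
- exact: bounded_measurable_comb.
- by move=> a b aT bT; rewrite mul1r mulNr; exact: payoff_mix.
Qed.

(** A strategy that is optimal at almost every type is optimal on average. *)
Lemma BNE_mean_le (s : strategy_profile G) l (r : R -> 'rV[R]_(dim G l)) :
  BNE s -> strategy r -> mean_Ucost l s <= mean_Ucost l (deviate s r).
Proof.
move=> [sS opt] rS; have sr := strategies_deviate sS rS.
rewrite !(mean_UcostE reg)//; apply: ae_le_Rintegral.
- exact: measurable_types.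
- exact: integrable_payoff_inner reg _ _ sS.
- exact: integrable_payoff_inner reg _ _ sr.
move: (opt l); apply: filterS; first exact: (ae_filter_ringOfSetsType leb).
move=> a opta aT.
rewrite -!(Ucost_marginal reg)// ler_wpM2r//.
  exact/ltW/(regular_marginal reg).
suff -> : Ucost l (deviate s r) a = Ucost l (deviate s (cst (r a))) a.
  by apply: opta => //; exact: rS.2.
by apply: eq_Rintegral => b _; rewrite !play_deviate.
Qed.

(** Compare s with the mixture c r + (1 - c) s: its cost is at least that of s,
    while strong convexity bounds it above with a gain proportional to
    c (1 - c). Dividing by c and letting c tend to 0 gives the claim. *)
Lemma BNE_strong_min (mu : R) (s : strategy_profile G) l
    (r : R -> 'rV[R]_(dim G l)) :
  costs_convex G mu -> BNE s -> strategy r ->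
  mu / 2 * sqHnorm (fun a => r a - s l a) <=
    mean_Ucost l (deviate s r) - mean_Ucost l s.
Proof.
move=> mu_cvx sB rS; have sS := sB.1.
set H := sqHnorm _; set D := _ - _.
have D0 : 0 <= D by rewrite subr_ge0; exact: BNE_mean_le.
have scaled c : 0 < c < 1 -> (1 - c) * (mu / 2 * H) <= D.
  move=> /andP[c0 c1].
  have c01 : 0 <= c <= 1 by rewrite !ltW.
  have h1 := mean_Ucost_mix mu_cvx sS rS c01.
  have h2 := BNE_mean_le sB (strategy_mix c01 rS (sS l)).
  rewrite -(ler_pM2l c0) /D.
  move: (le_trans h2 h1); rewrite -/H.
  by move: (mean_Ucost _ _) (mean_Ucost _ _) H => x y z; clear; lra.
exact: le_of_scaled.
Qed.

(** Let F be the expected cost of the first player, and let U and V be its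
    values when the first, respectively the second, player moves from s to s'.
    Strong minimality of s bounds mu/2 times the sum of the squared distances
    by (U - F(s)) + (F(s) - V) = U - V, and the approximate optimality of s'
    gives U <= F(s') + e and V >= F(s') - e. *)
Lemma eps_BNE_close (mu e : R) (s s' : strategy_profile G) l :
  zero_sum G -> costs_convex G mu -> BNE s -> eps_BNE e s' ->
  sqHnorm (fun a => s' l a - s l a) <= 4 * e / mu.
Proof.
move=> Z mu_cvx sB [e0 s'S eB]; have mu0 := mu_cvx.1; have sS := sB.1.
(* Moving one player from s to s' and moving the other from s' to s give the
   same pair. *)
have crossE k : deviate s (s' k) = deviate s' (s (~~ k)).
  apply: functional_extensionality_dep => j; rewrite /deviate.
  by case: k; case: j => /=; do ?[rewrite dfwithin|rewrite dfwithout//].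
have H0 k : 0 <= sqHnorm (fun a => s' k a - s k a).
  rewrite (sqHnormE sS (s'S k)); apply: Rintegral_ge0 => a aT.
  apply: Rintegral_ge0 => b bT; rewrite mulr_ge0 ?sqr_ge0//.
  by apply: density_ge0 => j; exact: typed_prof.
have m0 := BNE_strong_min (r := s' false) mu_cvx sB (s'S false).
have m1 := BNE_strong_min (r := s' true) mu_cvx sB (s'S true).
have z k : mean_Ucost true (deviate s (s' k)) =
    - mean_Ucost false (deviate s (s' k)).
  exact: (mean_Ucost_zero_sum reg Z (strategies_deviate sS (s'S k))).
have e1 := eB true _ (sS true).
have e2 := eB false _ (sS false).
rewrite -(crossE false) z (mean_Ucost_zero_sum reg Z s'S) in e1.
rewrite -(crossE true) in e2.
rewrite z (mean_Ucost_zero_sum reg Z sS) in m1.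
have hf := mulr_ge0 (ltW mu0) (H0 false).
have ht := mulr_ge0 (ltW mu0) (H0 true).
rewrite ler_pdivlMr// [leLHS]mulrC.
suff: mu * sqHnorm (fun a => s' false a - s false a) +
    mu * sqHnorm (fun a => s' true a - s true a) <= 4 * e.
  by case: l => h; apply: le_trans h; [rewrite lerDr; exact: hf|rewrite lerDl; exact: ht].
move: m0 m1 e1 e2.
generalize (mean_Ucost false (deviate s (s' false))) as u.
generalize (mean_Ucost false (deviate s (s' true))) as v.
generalize (mean_Ucost false s) as w; generalize (mean_Ucost false s') as w'.
generalize (sqHnorm (fun a => s' false a - s false a)) as hf'.
generalize (sqHnorm (fun a => s' true a - s true a)) as ht'.
by clear; move=> *; lra.
Qed.

End StrongConvexity.

(** * Step strategies of the discretized game *)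

Section Discretization.
Context {R : realType} (G : game R).
Local Notation leb := (@lebesgue_measure R).
Variables (A M P Q : R).
Hypothesis reg : regular_game G A M P Q.
Variables (N : bool -> nat) (theta : bool -> nat -> R).
Hypothesis N0 : forall l, (0 < N l)%N.
Hypothesis theta_first : forall l, theta l 0%N = tmin G l.
Hypothesis theta_last : forall l, theta l (N l) = tmax G l.
Hypothesis theta_step : forall l i, (0 < i <= N l)%N -> theta l i.-1 < theta l i.

Local Notation width l i := (theta l i - theta l i.-1).

Lemma theta_le l i j : (i <= j <= N l)%N -> theta l i <= theta l j.
Proof.
move=> /andP[ij jN]; elim: j ij jN => [|j IH].
  by rewrite leqn0 => /eqP ->.
rewrite leq_eqVlt => /orP[/eqP ->//|ij jN].
by apply: le_trans (IH ij (ltnW jN)) (ltW (theta_step (i := j.+1) _)).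
Qed.

Lemma theta_types l i : (i <= N l)%N -> types G l (theta l i).
Proof.
move=> iN; rewrite /types/= in_itv/= -theta_first -theta_last.
by rewrite !theta_le// iN leqnn.
Qed.

Lemma cell_types l i a : (0 < i <= N l)%N -> cell theta l i a -> types G l a.
Proof.
move=> /andP[i0 iN]; rewrite /cell/types/= !in_itv/= => /andP[a1 a2].
have /= := theta_types (l := l) (leq_trans (leq_pred i) iN).
have /= := theta_types iN.
rewrite /types/= !in_itv/= => /andP[_ h1] /andP[h2 _].
by rewrite (le_trans h2 (ltW a1)) (le_trans a2 h1).
Qed.

Lemma width_gt0 l i : (0 < i <= N l)%N -> 0 < width l i.
Proof. by move=> /theta_step; rewrite subr_gt0. Qed.

Lemma width_le_mesh l i : (0 < i <= N l)%N -> width l i <= mesh N theta.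
Proof.
move=> iN; rewrite /mesh.
apply: le_trans (le_bigmax _ _ l); apply: (bigmax_sup_seq _ i) => //.
by rewrite mem_index_iota ltnS.
Qed.

Lemma mesh_gt0 : 0 < mesh N theta.
Proof.
have h : (0 < 1 <= N false)%N by rewrite N0.
exact: lt_le_trans (width_gt0 h) (width_le_mesh h).
Qed.

Lemma cell_measure l i : (0 < i <= N l)%N ->
  fine (leb (cell theta l i)) = width l i.
Proof.
by move=> /theta_step h; rewrite /cell lebesgue_measure_itv/= lte_fin h.
Qed.

Lemma cell_finite l i : (leb (cell theta l i) < +oo)%E.
Proof. by rewrite /cell lebesgue_measure_itv; case: ifP => _; rewrite ?ltry. Qed.

Lemma measurable_cell l i : measurable (cell theta l i).
Proof. exact: measurable_itv. Qed.

Lemma types_measure l : fine (leb (types G l)) = tmax G l - tmin G l.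
Proof.
rewrite /types lebesgue_measure_itv/= lte_fin.
have := regular_types reg l; rewrite le_eqVlt => /orP[/eqP ->|->//].
by rewrite ltxx subrr.
Qed.

Lemma sum_widths l : \sum_(1 <= i < (N l).+1) width l i = tmax G l - tmin G l.
Proof. by rewrite big_add1/= telescope_sumr// theta_first theta_last. Qed.

Lemma round_up_cell l i a : (0 < i <= N l)%N -> cell theta l i a ->
  round_up N theta l a = theta l i.
Proof.
move=> /andP[i0 iN]; rewrite /cell/= in_itv/= => /andP[a1 a2].
apply/eqP; rewrite eq_le /round_up big_nat_cond; apply/andP; split.
  by apply: (bigmin_inf_seq _ i); rewrite ?mem_index_iota ?ltnS ?i0 ?iN.
apply: le_bigmin => [|j /andP[/andP[j0 jN] aj]].
  by rewrite theta_le ?iN/=.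
have [ij|ji] := leqP i j; first by rewrite theta_le// ij.
have : theta l j <= theta l i.-1.
  by rewrite theta_le// (leq_trans (leq_pred i) iN) andbT -ltnS prednK.
by move=> /(le_trans aj); rewrite leNgt a1.
Qed.

Lemma round_up_first l : round_up N theta l (tmin G l) = theta l 1%N.
Proof.
rewrite -theta_first; apply/eqP; rewrite eq_le /round_up big_nat_cond.
have N1 := N0 l.
apply/andP; split.
  apply: (bigmin_inf_seq _ 1%N); rewrite ?mem_index_iota ?ltnS ?N1//=.
  by rewrite theta_le.
apply: le_bigmin => [|j /andP[/andP[j0 jN] aj]]; apply: theta_le.
  by rewrite N1 leqnn.
by rewrite j0 -ltnS.
Qed.

(** The left endpoint of the types lies in no cell but is rounded to the first
    node, so that with closed cells no type is exceptional. *)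
Lemma round_upP l a : types G l a -> exists i,
  [/\ (0 < i <= N l)%N, theta l i.-1 <= a <= theta l i &
      round_up N theta l a = theta l i].
Proof.
rewrite /types/= in_itv/= => /andP[].
rewrite le_eqVlt => /orP[/eqP <- _|a0 aN].
  exists 1%N; rewrite N0 round_up_first -theta_first lexx.
  by split=> //; apply: ltW; apply: (theta_step (i := 1%N)); exact: N0.
have ex : exists i, a <= theta l i by exists (N l); rewrite theta_last.
(* The least node above a ends the cell of a. *)
case: (ex_minnP ex) => i ai mini.
have iN : (i <= N l)%N by apply: mini; rewrite theta_last.
have i0 : (0 < i)%N.
  by case: i ai {mini iN} => //; rewrite theta_first leNgt a0.
have ia : theta l i.-1 < a.
  rewrite ltNge; apply/negP => /mini.
  by rewrite leqNgt prednK ?leqnn.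
exists i; rewrite i0 iN (ltW ia) ai; split=> //.
by apply: round_up_cell; rewrite ?i0// /cell/= in_itv/= ia.
Qed.

Lemma Rintegral_cells l (g : R -> R) :
  leb.-integrable (types G l) (EFin \o g) ->
  \int[leb]_(a in types G l) g a =
  \sum_(1 <= i < (N l).+1) \int[leb]_(a in cell theta l i) g a.
Proof.
move=> ig; rewrite /types -theta_first -theta_last.
suff H n : (n <= N l)%N -> \int[leb]_(a in `[theta l 0%N, theta l n]) g a =
    \sum_(1 <= i < n.+1) \int[leb]_(a in cell theta l i) g a by exact: H.
elim: n => [|n IH] nN; first by rewrite set_itv1 Rintegral_set1 big_geq.
rewrite big_nat_recr//= -IH; last exact: ltnW.
apply/eqP; rewrite addrC -subr_eq; apply/eqP.
apply: Rintegral_itvB; rewrite ?bnd_simp.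
- apply: integrableS ig; [exact: measurable_itv|exact: measurable_itv|].
  move=> x; rewrite /types/= !in_itv/= -theta_first -theta_last.
  by move=> /andP[-> /le_trans -> //]; rewrite theta_le// nN/=.
- by apply: theta_le; exact: ltnW.
- by apply: ltW; apply: (theta_step (i := n.+1)).
Qed.

Variable sd : strategy_profile G.
Hypothesis sd_actions : forall l i, (0 < i <= N l)%N -> actions (sd l (theta l i)).
Local Notation step := (step_extension N theta sd).

Lemma step_strategies : strategies step.
Proof.
move=> l; split=> [j|a aT]; last first.
  by have [i [iN _ e]] := round_upP aT; rewrite /step_extension e; exact: sd_actions.
rewrite /types -theta_first -theta_last.
suff H n : (n <= N l)%N ->
    measurable_fun `[theta l 0%N, theta l n] (fun a => step l a 0 j) by exact: H.
elim: n => [|n IH] nN.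
  by rewrite set_itv1; exact: measurable_fun_set1.
have -> : `[theta l 0%N, theta l n.+1]%classic =
    `[theta l 0%N, theta l n]%classic `|` cell theta l n.+1.
  apply: (@itv_bndbnd_setU _ _ (BLeft (theta l 0%N)) (BRight (theta l n))
    (BRight (theta l n.+1))); rewrite bnd_simp.
    by apply: theta_le; exact: ltnW.
  by apply: ltW; apply: (theta_step (i := n.+1)).
apply/measurable_funU; [exact: measurable_itv|exact: measurable_itv|].
split; first by apply: IH; exact: ltnW.
apply: (eq_measurable_fun (cst (sd l (theta l n.+1) 0 j))) => //.
by move=> a; rewrite inE => ac; rewrite /step_extension (round_up_cell (i := n.+1)).
Qed.

Local Notation h := (mesh N theta).

(** Within a rectangle each type moves by at most the mesh, hence the density by
    at most 2 P mesh. The bound is symmetric in the players and serves both,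
    although the mass is defined by integrating in a fixed order. *)
Lemma Pd_near (i : bool -> nat) : (forall k, (0 < i k <= N k)%N) ->
  `|Pd G theta i - density G (fun k => theta k (i k)) *
      (width false (i false) * width true (i true))| <=
  2 * P * h * (width false (i false) * width true (i true)).
Proof.
move=> iN; set p := density G _.
have near a b : cell theta false (i false) a -> cell theta true (i true) b ->
    `|density G (prof false a b) - p| <= 2 * P * h.
  move=> ac bc.
  have [x0 x0A] := base_profile (regular_actions reg).
  have abT : typed G (prof false a b).
    by apply: typed_prof; [exact: cell_types ac|exact: cell_types bc].
  have tT : typed G (fun k => theta k (i k)).
    by move=> k; apply: theta_types; case/andP: (iN k).
  have := density_modulus reg x0A x0A abT tT.
  move=> /le_trans; apply; rewrite [2 * P]mulrC -mulrA ler_wpM2l ?(density_modulus_ge0 reg)//.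
  rewrite /profile_dist big_bool/= !subrr !norm2_0 !add0r.
  move: ac bc; rewrite /cell/= !in_itv/= => /andP[a1 a2] /andP[b1 b2].
  have h0 := width_le_mesh (iN false); have h1 := width_le_mesh (iN true).
  by rewrite /prof/= !ler0_norm ?subr_le0//; lra.
have mT k : measurable (cell theta k (i k)) by exact: measurable_cell.
have fT k : (leb (cell theta k (i k)) < +oo)%E by exact: cell_finite.
have mg : measurable_fun (cell theta false (i false) `*` cell theta true (i true))
    (fun z : R * R => density G (prof false z.1 z.2)).
  apply: measurable_funS (bounded_measurable_density reg false).1.
    by apply: measurableX; exact: measurable_types.
  by move=> z [z1 z2]; split; [exact: cell_types z1|exact: cell_types z2].
have bg a b : cell theta false (i false) a -> cell theta true (i true) b ->
    `|density G (prof false a b)| <= Q.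
  move=> ac bc.
  have [x0 x0A] := base_profile (regular_actions reg).
  apply: (density_bound reg x0A).
  by apply: typed_prof; [exact: cell_types ac|exact: cell_types bc].
have ib a : cell theta false (i false) a ->
    leb.-integrable (cell theta true (i true)) (EFin \o (fun b => density G (prof false a b))).
  exact: (integrable_section (mT _) (mT _) (fT _) mg bg).
have ia := integrable_inner (mT _) (mT _) (fT _) (fT _) mg bg.
have inner a : cell theta false (i false) a ->
    `|\int[leb]_(b in cell theta true (i true)) density G (prof false a b) -
      p * width true (i true)| <= 2 * P * h * width true (i true).
  move=> ac.
  have := @Rintegral_near_cst _ _ _ leb _ (mT true) _ _ _ (fT true) (ib _ ac)
    (fun b => near a b ac).
  by rewrite cell_measure.
have := @Rintegral_near_cst _ _ _ leb _ (mT false) _ _ _ (fT false) ia inner.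
rewrite cell_measure// /Pd; congr (`|_ - _| <= _); ring.
Qed.

Lemma Pd_ge0 (i : bool -> nat) : (forall k, (0 < i k <= N k)%N) ->
  0 <= Pd G theta i.
Proof.
move=> iN; apply: Rintegral_ge0 => a ac; apply: Rintegral_ge0 => b bc.
apply: density_ge0 => k.
by apply: typed_prof; [exact: cell_types ac|exact: cell_types bc].
Qed.

Local Notation node l i j := (prof l (theta l i) (theta (~~ l) j)).

(** On a cell of the opponent, the profile played is the one at the node. *)
Lemma play_step l i j (u : 'rV[R]_(dim G l)) a b :
  cell theta (~~ l) j b -> (0 < j <= N (~~ l))%N ->
  play (deviate step (cst u)) (prof l a b) =
  play (deviate sd (cst u)) (node l i j).
Proof.
move=> bc jN; apply: functional_extensionality_dep => k; rewrite /play /deviate.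
have [<-|lk] := eqVneq l k; first by rewrite !dfwithin.
have -> : k = ~~ l by move: lk; case: (k); case: (l).
rewrite !dfwithout; try by case: (l).
rewrite /step_extension /prof.
have -> : (~~ l == l) = false by case: (l).
by rewrite (round_up_cell jN bc).
Qed.

(** The objective of the discrete type i without the normalization that turns
    rectangle masses into conditional probabilities. *)
Definition node_cost l i (u : 'rV[R]_(dim G l)) : R :=
  \sum_(1 <= j < (N (~~ l)).+1)
    mean_cost l (play (deviate sd (cst u)) (node l i j)) (node l i j) *
    Pd G theta (prof l i j).

Lemma strategies_deviate_cst (s : strategy_profile G) l (u : 'rV[R]_(dim G l)) :
  strategies s -> actions u -> strategies (deviate s (cst u)).
Proof. by move=> sS uA; apply: strategies_deviate. Qed.

(** Cell by cell there are two errors. Replacing the types by the node in the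
    weighted cost costs 2 (A Q + M P) mesh per unit of area, where A Q + M P is
    the Lipschitz constant of the weighted cost. Replacing the density at the
    node times the area by the mass of the rectangle costs 2 P mesh per unit of
    area, times the bound M of the cost. *)
Lemma node_cost_near l i a (u : 'rV[R]_(dim G l)) :
  (0 < i <= N l)%N -> theta l i.-1 <= a <= theta l i -> actions u ->
  `|(\int[leb]_(b in types G (~~ l)) payoff l (deviate step (cst u)) a b) *
      width l i - node_cost i u| <=
  2 * ((A * Q + M * P) + M * P) * h * width l i *
    (tmax G (~~ l) - tmin G (~~ l)).
Proof.
move=> iN ai uA.
have aT : types G l a.
  have [i0 iN'] := andP iN; have [a1 a2] := andP ai.
  have := theta_types (l := l) (leq_trans (leq_pred i) iN').
  have := theta_types iN'.
  rewrite /types/= !in_itv/= => /andP[_ h1] /andP[h2 _].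
  by rewrite (le_trans h2 a1) (le_trans a2 h1).
have dS := strategies_deviate_cst step_strategies uA.
have ip := integrable_payoff reg dS aT.
rewrite Rintegral_cells// mulr_suml -sumrB -sum_widths mulr_sumr.
apply: le_trans (ler_norm_sum _ _ _) _.
rewrite big_nat_cond [leRHS]big_nat_cond; apply: ler_sum => j.
rewrite andbT ltnS => jN.
have W0 : 0 <= A * Q + M * P.
  by rewrite addr_ge0// mulr_ge0//; case: reg.
have M0 := cost_bound_ge0 reg.
have wi := width_gt0 iN; have wj := width_gt0 jN.
set t := node l i j; set x := play (deviate sd (cst u)) t.
have tT : typed G t.
  by apply: typed_prof; apply: theta_types; [case/andP: iN|case/andP: jN].
have tc : cell theta (~~ l) j (theta (~~ l) j).
  by rewrite /cell/= in_itv/= lexx andbT theta_step.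
have xA : admissible x.
  rewrite /x -(play_step i u a tc jN); apply: admissible_play => //.
  by apply: typed_prof => //; exact: cell_types tc.
have near : `|\int[leb]_(b in cell theta (~~ l) j)
    payoff l (deviate step (cst u)) a b - weighted_cost l x t * width (~~ l) j| <=
    (2 * (A * Q + M * P) * h) * width (~~ l) j.
  rewrite -cell_measure//; apply: Rintegral_near_cst.
  - exact: measurable_cell.
  - exact: cell_finite.
  - apply: integrableS ip; [exact: measurable_types|exact: measurable_cell|].
    by move=> b; exact: cell_types.
  - move=> b bc; rewrite /payoff (play_step i u a bc jN) -/t -/x.
    have bT := cell_types jN bc.
    apply: le_trans (weighted_cost_lipschitz reg l xA xA (typed_prof aT bT) tT) _.
    rewrite [2 * _]mulrC -mulrA ler_wpM2l//.
    have -> : profile_dist x x (prof l a b) t =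
        `|a - theta l i| + `|b - theta (~~ l) j|.
      rewrite /profile_dist big_bool/= !subrr !norm2_0 !add0r /t /prof.
      by case: (l) => //; rewrite addrC.
    move: bc ai; rewrite /cell/= in_itv/= => /andP[b1 b2] /andP[a1 a2].
    have hi := width_le_mesh iN; have hj := width_le_mesh jN.
    by rewrite !ler0_norm ?subr_le0//; lra.
have pd : `|Pd G theta (prof l i j) - density G t * (width l i * width (~~ l) j)| <=
    2 * P * h * (width l i * width (~~ l) j).
  have ijN k : (0 < prof l i j k <= N k)%N.
    by move: iN jN; case: (l); case: k.
  have := Pd_near ijN.
  have -> : (fun k => theta k (prof l i j k)) = t.
    by apply/funext => k; rewrite /t; case: (l); case: k.
  have -> // : width false (prof l i j false) * width true (prof l i j true) =
    width l i * width (~~ l) j.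
  by case: (l) => //; rewrite mulrC.
have fM : `|mean_cost l x t| <= M by exact: (cost_bound reg l xA tT).
move: near pd fM; rewrite /weighted_cost.
move: (\int[leb]_(b in _) _) (Pd G theta _) (mean_cost l x t) (density G t) => I p f q.
move: wi wj; move: (width l i) (width (~~ l) j) => wi wj wi0 wj0 H1 H2 H3.
(* I is the integral over the cell j, f the cost and q the density at the
   node, p the mass of the rectangle with sides wi and wj. *)
rewrite (_ : I * wi - f * p = (I - f * q * wj) * wi + f * (q * (wi * wj) - p));
  last by ring.
apply: le_trans (ler_normD _ _) _; rewrite !normrM (gtr0_norm wi0) (distrC (q * _)).
have K1 := ler_wpM2r (ltW wi0) H1.
have K2 := ler_pM (normr_ge0 _) (normr_ge0 _) H3 H2.
apply: le_trans (lerD K1 K2) _; rewrite le_eqVlt; apply/orP; left; apply/eqP; ring.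
Qed.

(** If the marginal mass vanishes, so do the nonnegative masses that it sums,
    and the identity survives the division by 0. *)
Lemma Pd_conditionalE l i j : (0 < i <= N l)%N -> (0 < j <= N (~~ l))%N ->
  Pd G theta (prof l i j) =
  Pd_marginal G N theta l i * Pd_conditional G N theta l j i.
Proof.
move=> iN jN; rewrite /Pd_conditional mulrC.
have ge0 k : (1 <= k < (N (~~ l)).+1)%N -> 0 <= Pd G theta (prof l i k).
  move=> kN; apply: Pd_ge0 => b; move: iN kN; rewrite ltnS; case: (l); case: b => //.
have [m0|m0] := eqVneq (Pd_marginal G N theta l i) 0; last by rewrite divfK.
rewrite m0 mulr0; move/eqP: m0; rewrite /Pd_marginal big_nat_cond psumr_eq0.
  by move=> /allP /(_ j); rewrite mem_index_iota ltnS jN => /(_ isT) /= /eqP ->.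
by move=> k /andP[kN _]; exact: ge0.
Qed.

Hypothesis sd_DBNE : DBNE N theta sd.

Lemma node_cost_opt l i (u : 'rV[R]_(dim G l)) : (0 < i <= N l)%N ->
  actions u -> node_cost i (sd l (theta l i)) <= node_cost i u.
Proof.
move=> iN uA.
have costE (v : 'rV[R]_(dim G l)) : node_cost i v =
    Pd_marginal G N theta l i * Ucost_d N theta l (deviate sd (cst v)) i.
  rewrite /node_cost /Ucost_d mulr_sumr big_nat_cond [RHS]big_nat_cond.
  apply: eq_bigr => j; rewrite andbT ltnS => jN.
  by rewrite (Pd_conditionalE iN jN); ring.
rewrite !costE; apply: ler_wpM2l.
  rewrite /Pd_marginal big_nat_cond; apply: sumr_ge0 => j; rewrite andbT ltnS => jN.
  by apply: Pd_ge0 => b; move: iN jN; case: (l); case: b.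
apply: le_trans (sd_DBNE.2 l i iN u uA); rewrite le_eqVlt; apply/orP; left.
apply/eqP; apply: eq_bigr => j _; congr (mean_cost _ _ _ * _).
by rewrite play_deviate [RHS]play_self.
Qed.

(** At each own type, [node_cost_near] is used twice, for the deviation and for
    the step strategy; this doubles the constant 2 there. *)
Lemma step_eps_BNE_bound l (r : R -> 'rV[R]_(dim G l)) : strategy r ->
  mean_Ucost l step -
    4 * ((A * Q + M * P) + M * P) * h *
      ((tmax G false - tmin G false) * (tmax G true - tmin G true)) <=
  mean_Ucost l (deviate step r).
Proof.
move=> rS; have stS := step_strategies.
rewrite !(mean_UcostE reg)//; last exact: strategies_deviate.
set K := _ + M * P; set e := 4 * K * h * (tmax G (~~ l) - tmin G (~~ l)).
have mT := @measurable_types _ G l; have fT := @types_finite _ G l.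
have ir := integrable_payoff_inner reg l (strategies_deviate stS rS).
have ist := integrable_payoff_inner reg l stS.
have ie : leb.-integrable (types G l) (EFin \o cst e).
  by apply: (@integrable_bounded _ _ _ leb _ _ `|e|).
have -> : 4 * K * h * ((tmax G false - tmin G false) * (tmax G true - tmin G true)) =
    \int[leb]_(a in types G l) cst e a.
  by rewrite Rintegral_cst// types_measure /e; case: (l) => /=; ring.
rewrite -RintegralB//; apply: le_Rintegral => //.
  have := @integrableB _ _ _ leb _ mT _ _ ist ie; congr (integrable _ _ _).
move=> a aT; have [i [iN ai ea]] := round_upP aT.
have payE (q : R -> 'rV[R]_(dim G l)) b :
    payoff l (deviate step q) a b = payoff l (deviate step (cst (q a))) a b.
  by rewrite /payoff !play_deviate.
have stE b : payoff l step a b =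
    payoff l (deviate step (cst (sd l (theta l i)))) a b.
  by rewrite /payoff play_deviate [in LHS]play_self /step_extension ea.
under eq_Rintegral do rewrite stE.
under [leRHS]eq_Rintegral do rewrite payE.
have n1 := node_cost_near iN ai (sd_actions iN).
have n2 := node_cost_near iN ai (rS.2 _ aT).
have n3 := node_cost_opt iN (rS.2 _ aT).
have wi := width_gt0 iN.
rewrite -(ler_pM2r wi) /e /cst.
move: n1 n2; rewrite !ler_norml -/K => /andP[_ n1] /andP[n2 _].
move: n1 n2 n3.
move: (\int[leb]_(b in _) _) (\int[leb]_(b in _) _) (node_cost _ _) (node_cost _ _).
move: (width l i) (tmax _ _ - _) (mesh _ _) => w T m x y z t.
by clear; move=> *; lra.
Qed.

End Discretization.

(** * Refinement of the grid *)

Lemma lipschitz_within_continuous {R : realType} (D : set R) (f : R -> R) (k : R) :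
  (forall x y, D x -> D y -> `|f x - f y| <= k * `|x - y|) ->
  {within D, continuous f}.
Proof.
move=> lf; apply/subspace_continuousP => x Dx.
apply/cvgrPdist_le => e e0; rewrite near_withinE.
have k1 : 0 < `|k| + 1 by rewrite ltr_pwDr.
have d0 : 0 < e / (`|k| + 1) by rewrite divr_gt0.
near=> y => Dy.
apply: le_trans (lf x y Dx Dy) _.
have xy : `|x - y| <= e / (`|k| + 1).
  near: y; apply/nbhs_ballP; exists (e / (`|k| + 1)) => //= y.
  by rewrite -ball_normE /=; exact: ltW.
apply: (@le_trans _ _ ((`|k| + 1) * (e / (`|k| + 1)))).
  apply: (@le_trans _ _ (`|k| * `|x - y|)); first by rewrite ler_wpM2r// ler_norm.
  by apply: ler_pM => //; rewrite lerDl.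
by rewrite mulrC divfK// gt_eqF.
Unshelve. all: by end_near.
Qed.

Section MeshLimit.
Context {R : realType} (G : game R).
Local Notation leb := (@lebesgue_measure R).
Variables (A M P Q : R).
Hypothesis reg : regular_game G A M P Q.

(** Integrating the Lipschitz bound of the density over the opponent's types. *)
Lemma marginal_lipschitz l a a' : types G l a -> types G l a' ->
  `|marginal G l a - marginal G l a'| <=
  P * (tmax G (~~ l) - tmin G (~~ l)) * `|a - a'|.
Proof.
move=> aT aT'.
have mT := @measurable_types _ G (~~ l); have fT := @types_finite _ G (~~ l).
have ia := integrable_density reg aT; have ia' := integrable_density reg aT'.
have id : leb.-integrable (types G (~~ l))
    (EFin \o (fun b => density G (prof l a b) - density G (prof l a' b))).
  have := @integrableB _ _ _ leb _ mT _ _ ia ia'; congr (integrable _ _ _).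
rewrite /marginal -RintegralB//.
have near b : types G (~~ l) b ->
    `|density G (prof l a b) - density G (prof l a' b) - 0| <= P * `|a - a'|.
  move=> bT; rewrite subr0; have [x0 x0A] := base_profile (regular_actions reg).
  have := density_modulus reg x0A x0A (typed_prof aT bT) (typed_prof aT' bT).
  have -> // : profile_dist x0 x0 (prof l a b) (prof l a' b) = `|a - a'|.
  rewrite /profile_dist big_bool/= !subrr !norm2_0 !add0r /prof.
  by case: (l); rewrite subrr normr0 ?addr0 ?add0r.
have := @Rintegral_near_cst _ _ _ leb _ mT _ _ _ fT id near.
by rewrite mul0r subr0 (types_measure reg) mulrAC.
Qed.

Lemma marginal_lower_bound :
  exists2 c : R, 0 < c & forall l a, types G l a -> c <= marginal G l a.
Proof.
have low l : exists2 c : R, 0 < c & forall a, types G l a -> c <= marginal G l a.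
  have := EVT_min (regular_types reg l)
    (lipschitz_within_continuous (@marginal_lipschitz l)).
  by move=> [a0 a0T a0min]; exists (marginal G l a0); first exact: (regular_marginal reg).
have [c0 c0gt c0le] := low false; have [c1 c1gt c1le] := low true.
exists (Num.min c0 c1); first by rewrite lt_min c0gt.
by case=> a aT; rewrite ge_min ?c0le ?c1le// orbT.
Qed.

(** A cell has mass 1/N and, the marginal being at least c, mass at least c times
    its width. *)
Lemma mesh_le (c : R) (N : bool -> nat) (theta : bool -> nat -> R) : 0 < c ->
  (forall l a, types G l a -> c <= marginal G l a) ->
  (forall l, (0 < N l)%N) -> equiprobable_grid G N theta ->
  mesh N theta <= c^-1 * ((N false)%:R^-1 + (N true)%:R^-1).
Proof.
move=> c0 lowc N0 grid.
have t0 l : theta l 0%N = tmin G l by have [] := grid l.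
have tN l : theta l (N l) = tmax G l by have [] := grid l.
have ts l i : (0 < i <= N l)%N -> theta l i.-1 < theta l i.
  by have [_ _ + _] := grid l; apply.
have mass l i : (0 < i <= N l)%N ->
    \int[leb]_(a in cell theta l i) marginal G l a = (N l)%:R^-1.
  by have [_ _ _] := grid l; apply.
have bound l i : (0 < i <= N l)%N ->
    theta l i - theta l i.-1 <= c^-1 * (N l)%:R^-1.
  move=> iN; rewrite ler_pdivlMl// -(mass l i iN) -(cell_measure ts iN).
  rewrite -Rintegral_cst; last exact: measurable_cell.
  have mc := measurable_cell theta l i; have fc := cell_finite theta l i.
  have sub := cell_types t0 tN ts iN.
  apply: le_Rintegral => //.
  - by apply: (@integrable_bounded _ _ _ leb _ _ `|c|).
  - have [mp [B bB]] := bounded_measurable_density reg l.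
    have := integrable_inner (measurable_types G l) (measurable_types G (~~ l))
      (types_finite G l) (types_finite G (~~ l)) mp bB.
    apply: integrableS => //; exact: measurable_types.
  - by move=> a /sub; exact: lowc.
apply: bigmax_le => [|l _]; first by rewrite mulr_ge0 ?addr_ge0 ?invr_ge0 ?ler0n ?(ltW c0).
rewrite big_nat_cond; apply: bigmax_le => [|i].
  by rewrite mulr_ge0 ?addr_ge0 ?invr_ge0 ?ler0n ?(ltW c0).
rewrite andbT ltnS => iN; apply: le_trans (bound l i iN) _.
apply: ler_wpM2l; first by rewrite invr_ge0 ltW.
have Nge k : 0 <= (N k)%:R^-1 :> R by rewrite invr_ge0 ler0n.
by case: (l); rewrite ?lerDl ?lerDr Nge.
Qed.

End MeshLimit.

(** The constant comes from [step_eps_BNE_bound]; adding 1 to it makes the error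
    positive, as the definition of an approximate equilibrium requires. *)
Lemma discretization_error (R : realType) (G : game R) (A M P Q : R) :
  zero_sum G -> regular_game G A M P Q ->
  exists C : R, 0 < C /\
    forall (N : bool -> nat) (theta : bool -> nat -> R) (sd : strategy_profile G),
      (forall l, (0 < N l)%N) -> equiprobable_grid G N theta -> DBNE N theta sd ->
      exists eps1 : R,
        [/\ 0 < eps1 <= C * mesh N theta,
            eps_BNE eps1 (step_extension N theta sd) &
            forall (mu : R) (s : strategy_profile G),
              costs_convex G mu -> BNE s ->
              forall l,
                sqHnorm (fun a => step_extension N theta sd l a - s l a)
                  <= 4 * eps1 / mu].
Proof.
move=> Z reg.
pose K : R := 4 * (A * Q + M * P + M * P) *
  ((tmax G false - tmin G false) * (tmax G true - tmin G true)).
have K0 : 0 <= K.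
  have len l : 0 <= tmax G l - tmin G l by rewrite subr_ge0 (regular_types reg).
  by case: reg => *; rewrite !mulr_ge0// !addr_ge0// mulr_ge0.
exists (K + 1); split; first by rewrite ltr_wpDl.
move=> N theta sd N0 grid sdB.
have t0 l : theta l 0%N = tmin G l by have [] := grid l.
have tN l : theta l (N l) = tmax G l by have [] := grid l.
have ts l i : (0 < i <= N l)%N -> theta l i.-1 < theta l i.
  by have [_ _ + _] := grid l; apply.
have h0 : 0 < mesh N theta := mesh_gt0 N0 ts.
have eB : eps_BNE ((K + 1) * mesh N theta) (step_extension N theta sd).
  split; first by rewrite mulr_gt0// ltr_wpDl.
    exact: (step_strategies N0 t0 tN ts sdB.1).
  move=> l r rS; apply: le_trans (step_eps_BNE_bound reg N0 t0 tN ts sdB.1 sdB rS).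
  rewrite lerD2l lerN2 [leLHS]mulrAC -/K; apply: ler_wpM2r; first exact: ltW.
  by rewrite lerDl.
exists ((K + 1) * mesh N theta); split=> //.
  by rewrite lexx andbT mulr_gt0// ltr_wpDl.
by move=> mu s mu_cvx sB l; exact: (eps_BNE_close reg l Z mu_cvx sB eB).
Qed.

Theorem lemma4 (R : realType) (G : game R)
    (L : bool -> bool -> R) (Ltheta Lp : R) :
  zero_sum G ->
  actions_compact_convex G ->
  types_compact_interval G ->
  costs_lipschitz G L Ltheta ->
  density_lipschitz_marginal_gt0 G Lp ->
  (exists C : R, 0 < C /\
    forall (N : bool -> nat) (theta : bool -> nat -> R)
           (sd : strategy_profile G),
      (forall l, (0 < N l)%N) ->
      equiprobable_grid G N theta ->
      DBNE N theta sd ->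
      exists eps1 : R,
        [/\ 0 < eps1 <= C * mesh N theta,
            eps_BNE eps1 (step_extension N theta sd) &
            forall (mu : R) (s : strategy_profile G),
              costs_convex G mu -> BNE s ->
              forall l,
                sqHnorm (fun a => step_extension N theta sd l a - s l a)
                  <= 4 * eps1 / mu])
  /\
  (forall (mu : R) (s : strategy_profile G),
     costs_convex G mu -> BNE s ->
     forall (theta : nat * nat -> bool -> nat -> R)
            (sd : nat * nat -> strategy_profile G),
       (forall n : nat * nat, (0 < n.1)%N -> (0 < n.2)%N ->
          equiprobable_grid G (prof false n.1 n.2) (theta n) /\
          DBNE (prof false n.1 n.2) (theta n) (sd n)) ->
       forall l,
         Hnorm (fun a =>
           step_extension (prof false n.1 n.2) (theta n) (sd n) l a - s l a)
         @[n --> (\oo, \oo)] --> (0 : R)).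
Proof.
move=> Z HA HT HL HD.
have [A [M [P [Q reg]]]] := regular_game_exists HA HT HL HD.
have err := discretization_error Z reg; split=> // mu s mu_cvx sB theta sd sdB l.
have [C [C0 HC]] := err; have [c c0 lowc] := marginal_lower_bound reg.
have mu0 := mu_cvx.1.
apply/cvgrPdist_le => e e0.
have D0 : 0 < mu * c * e ^+ 2 by rewrite !mulr_gt0 ?exprn_gt0.
(* For at least K cells on each side, the bound 4 C mesh / mu on the squared
   distance is at most 8 C / (mu c K), which is below e^2. *)
pose K := (Num.truncn (8 * C / (mu * c * e ^+ 2))).+1.
have Kbig : 8 * C / (mu * c * e ^+ 2) < K%:R by rewrite truncnS_gt.
exists ([set n | (K <= n)%N], [set n | (K <= n)%N]) => /=.
  by split; exists K.
move=> n [/= n1 n2].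
have n10 : (0 < n.1)%N by exact: leq_trans n1.
have n20 : (0 < n.2)%N by exact: leq_trans n2.
have [grid dbne] := sdB n n10 n20.
have N0 k : (0 < prof false n.1 n.2 k)%N by case: k.
have [e1 [/andP[e10 e1C] _ close]] := HC _ _ _ N0 grid dbne.
have bnd := close mu s mu_cvx sB l.
have m0 := mesh_le reg c0 lowc N0 grid.
rewrite sub0r normrN ger0_norm ?sqrtr_ge0// /Hnorm.
rewrite -(ger0_norm (ltW e0)) -sqrtr_sqr ler_wsqrtr//.
apply: le_trans bnd _; rewrite ler_pdivrMr//.
have inv k : (K <= k)%N -> (k%:R : R)^-1 <= K%:R^-1.
  by move=> Kk; rewrite lef_pV2 ?posrE ?ltr0n ?ler_nat// (leq_trans _ Kk).
have m1 : mesh (prof false n.1 n.2) (theta n) <= c^-1 * (K%:R^-1 + K%:R^-1).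
  apply: le_trans m0 _; apply: ler_wpM2l; first by rewrite invr_ge0 ltW.
  by apply: lerD; exact: inv.
have m2 := le_trans e1C (ler_wpM2l (ltW C0) m1).
apply: (@le_trans _ _ (8 * C / c / K%:R)).
  apply: le_trans (ler_wpM2l _ m2) _ => //.
  by rewrite le_eqVlt; apply/orP; left; apply/eqP; ring.
rewrite ler_pdivrMr// ler_pdivrMr//.
move: Kbig; rewrite ltr_pdivrMr// => /ltW /le_trans; apply.
by rewrite le_eqVlt; apply/orP; left; apply/eqP; ring.
Qed.
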